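(* Let $T \subseteq T'$ be complete theories (in languages $L\subseteq L'$) and $\mathbb{M} \models T'$ a monster model. Let $H = (X,\gamma(x,y,z))$ be a definable group in $T'$, $G = (Y/F, \Gamma(x,y,z))$ a hyperdefinable group in $T$ (with $Y$ a partial type in finitely many variables), and assume $\iota(x,y)$ is a type-definable in $T'$ isomorphism between $H(\mathbb{M})$ and $G(\mathbb{M})$, all over a small set of real parameters $C \subseteq \mathbb{M}$. Then there are a group $G_0$ definable over $C$ in $T^{\mathrm{eq}}$ and a $C$-definable in $T'$ isomorphism $\iota'$ between $H$ and $G_0$.
   Context: $\gamma$ and $\Gamma$ denote the graphs of the group operations. A hyperdefinable group $(Y/F,\Gamma)$ over $C$ in $T$ consists of a $C$-type-definable (in $T$) set $Y$, a $C$-type-definable equivalence relation $F$ on it, and a partial type $\Gamma(x,y,z)$ over $C$, $F$-invariant in each coordinate, which is (the pull-back to representatives of) the graph of a group operation on $Y/F$. A type-definable isomorphism $\iota$ between $H$ and $G$ is given by a partial $L'$-type $\iota(x,y)$ over $C$, $F$-invariant in $y$, whose induced relation between $X$ and $Y/F$ is the graph of a group isomorphism. The parameters $C$ are real, i.e. elements of $\mathbb{M}$ rather than hyperimaginaries. $\iota'$ being definable in $T'$ means that its graph is (the pull-back to representatives is) $L'(C)$-definable. *)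

(* Defs.v *)
From mathcomp Require Import all_boot.
From Stdlib Require Import RelationClasses.
From Stdlib Require List.

Set Implicit Arguments.
Unset Strict Implicit.
Unset Printing Implicit Defensive.

Record lang : Type := Lang {
  sort : Type;
  func : Type;
  farity : func -> nat;
  fdom : forall f : func, 'I_(farity f) -> sort;
  fcod : func -> sort;
  rel : Type;
  rarity : rel -> nat;
  rdom : forall r : rel, 'I_(rarity r) -> sort }.
Arguments fdom {l} f _.
Arguments rdom {l} r _.

Record structure (L : lang) : Type := Structure {
  carrier :> sort L -> Type;
  carrier_inh : forall s, inhabited (carrier s);
  fint : forall f : func L, (forall i, carrier (fdom f i)) -> carrier (fcod f);
  rint : forall r : rel L, (forall i, carrier (rdom r i)) -> Prop }.
Arguments fint {L} _ f _.
Arguments rint {L} _ r _.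

(* A context of variables is a family [V : sort L -> Type]: [V s] is the type of
   the variables of sort [s].  [ext V s] has one more variable, of sort [s]. *)
Inductive ext (S : Type) (V : S -> Type) (s : S) : S -> Type :=
  | Old t : V t -> ext V s t
  | New : ext V s s.
Arguments Old {S V s t} _.
Arguments New {S V s}.

Definition vsum (S : Type) (V W : S -> Type) (s : S) : Type := (V s + W s)%type.
Definition void_ctx (S : Type) (s : S) : Type := void.

(* The tuple of variables (x_i)_(i : I), with x_i of sort [sigma i]. *)
Inductive vars (S I : Type) (sigma : I -> S) : S -> Type :=
  | TVar i : vars sigma (sigma i).
Arguments TVar {S I sigma} i.

Inductive term (L : lang) (V : sort L -> Type) : sort L -> Type :=
  | Var s : V s -> term V s
  | App (f : func L) : (forall i, term V (fdom f i)) -> term V (fcod f).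
Arguments Var {L V s} _.
Arguments App {L V} f _.

Inductive formula (L : lang) (V : sort L -> Type) : Type :=
  | Bot
  | Eq s : term V s -> term V s -> formula V
  | Rel (r : rel L) : (forall i, term V (rdom r i)) -> formula V
  | Imp : formula V -> formula V -> formula V
  | All s : formula (ext V s) -> formula V.
Arguments Bot {L V}.
Arguments Rel {L V} r _.
Arguments All {L V} s _.

Definition Neg (L : lang) (V : sort L -> Type) (phi : formula V) : formula V :=
  Imp phi Bot.

Definition env (S : Type) (V M : S -> Type) : Type := forall s, V s -> M s.
Definition tuple_of (S I : Type) (M : S -> Type) (sigma : I -> S) : Type :=
  forall i, M (sigma i).

Definition ext_env (S : Type) (V M : S -> Type) (s : S) (e : env V M) (a : M s) :
    env (ext V s) M :=
  fun t v => match v in ext _ _ t return M t with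
             | Old t x => e t x
             | New => a
             end.

Definition sum_env (S : Type) (V W M : S -> Type) (e : env V M) (e' : env W M) :
    env (vsum V W) M :=
  fun s v => match v with inl x => e s x | inr y => e' s y end.

Definition void_env (S : Type) (M : S -> Type) : env (@void_ctx S) M :=
  fun s v => match v with end.

Definition tup_env (S I : Type) (M : S -> Type) (sigma : I -> S)
    (a : tuple_of M sigma) : env (vars sigma) M :=
  fun s v => match v in vars _ s return M s with TVar i => a i end.

Fixpoint tval (L : lang) (M : structure L) (V : sort L -> Type) (e : env V M)
    (s : sort L) (t : term V s) : M s :=
  match t in term _ s return M s with
  | Var s x => e s x
  | App f args => fint M f (fun i => tval e (args i))
  end.

Fixpoint sat (L : lang) (M : structure L) (V : sort L -> Type)
    (phi : formula V) : env V M -> Prop :=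
  match phi with
  | Bot => fun _ => False
  | Eq _ t u => fun e => tval e t = tval e u
  | Rel r args => fun e => rint M r (fun i => tval e (args i))
  | Imp p q => fun e => sat p e -> sat q e
  | All s p => fun e => forall a : M s, sat p (ext_env e a)
  end.

Definition sentence (L : lang) : Type := formula (L := L) (@void_ctx (sort L)).
Definition theory (L : lang) : Type := sentence L -> Prop.

Definition models (L : lang) (M : structure L) (T : theory L) : Prop :=
  forall phi, T phi -> sat phi (void_env M).

Definition entails (L : lang) (T : theory L) (phi : sentence L) : Prop :=
  forall M : structure L, models M T -> sat phi (void_env M).

Definition complete (L : lang) (T : theory L) : Prop :=
  (exists M : structure L, models M T) /\
  forall phi, entails T phi \/ entails T (Neg phi).

Record sublang (L' : lang) : Type := Sublang {
  in_sort : sort L' -> Prop;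
  in_func : func L' -> Prop;
  in_rel : rel L' -> Prop;
  in_fdom : forall f, in_func f -> forall i, in_sort (fdom f i);
  in_fcod : forall f, in_func f -> in_sort (fcod f);
  in_rdom : forall r, in_rel r -> forall i, in_sort (rdom r i) }.

Definition lang_of (L' : lang) (L : sublang L') : lang := {|
  sort := {s | in_sort L s};
  func := {f | in_func L f};
  farity f := farity (sval f);
  fdom f i := exist _ (fdom (sval f) i) (in_fdom (svalP f) i);
  fcod f := exist _ (fcod (sval f)) (in_fcod (svalP f));
  rel := {r | in_rel L r};
  rarity r := rarity (sval r);
  rdom r i := exist _ (rdom (sval r) i) (in_rdom (svalP r) i) |}.
Coercion lang_of : sublang >-> lang.

Definition reduct (L' : lang) (L : sublang L') (M : structure L') : structure L :=
  @Structure L (fun s => M (sval s)) (fun s => carrier_inh M (sval s))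
    (fun f a => fint M (sval f) a) (fun r a => rint M (sval r) a).

Fixpoint lift_term (L' : lang) (L : sublang L') (V : sort L -> Type)
    (V' : sort L' -> Type) (h : forall s, V s -> V' (sval s))
    (s : sort L) (t : term V s) : term V' (sval s) :=
  match t in term _ s return term V' (sval s) with
  | Var s x => Var (h s x)
  | App f args => @App L' V' (sval f) (fun i => lift_term h (args i))
  end.

Definition lift_ext (L' : lang) (L : sublang L') (V : sort L -> Type)
    (V' : sort L' -> Type) (h : forall s, V s -> V' (sval s)) (s t : sort L)
    (v : ext V s t) : ext V' (sval s) (sval t) :=
  match v in ext _ _ t return ext V' (sval s) (sval t) with
  | Old t x => Old (h t x)
  | New => New
  end.

Fixpoint lift_formula (L' : lang) (L : sublang L') (V : sort L -> Type)
    (phi : formula V) :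
    forall V' : sort L' -> Type, (forall s, V s -> V' (sval s)) -> formula V' :=
  match phi with
  | Bot => fun V' h => Bot
  | Eq s t u => fun V' h => Eq (lift_term h t) (lift_term h u)
  | Rel r args =>
      fun V' h => @Rel L' V' (sval r) (fun i => lift_term h (args i))
  | Imp p q => fun V' h => Imp (lift_formula p h) (lift_formula q h)
  | All s p => fun V' h => All (sval s) (lift_formula p (lift_ext h (s := s)))
  end.

Definition lift_sentence (L' : lang) (L : sublang L') (phi : sentence L) :
    sentence L' := lift_formula phi (fun s (x : @void_ctx (sort L) s) => x).

Definition subtheory (L' : lang) (L : sublang L') (T : theory L)
    (T' : theory L') : Prop :=
  forall phi, T phi -> T' (lift_sentence phi).

Definition paramset (L : lang) (M : structure L) : Type :=
  forall s, M s -> Prop.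

Definition params (L : lang) (M : structure L) (C : paramset M) (s : sort L) :
    Type := {a : M s | C s a}.

(* An L(C)-formula in the variables [V]: the constants naming the elements of
   [C] are rendered as further variables, always evaluated at themselves. *)
Definition formula_over (L : lang) (M : structure L) (C : paramset M)
    (V : sort L -> Type) : Type := formula (L := L) (vsum V (params C)).

Definition holds (L : lang) (M : structure L) (C : paramset M)
    (V : sort L -> Type) (phi : formula_over C V) (e : env V M) : Prop :=
  sat phi (sum_env e (fun s (c : params C s) => sval c)).

(* Consistency of the partial type is not part of the definition. *)
Definition type_over (L : lang) (M : structure L) (C : paramset M)
    (V : sort L -> Type) : Type := formula_over C V -> Prop.

Definition realizes (L : lang) (M : structure L) (C : paramset M)
    (V : sort L -> Type) (e : env V M) (p : type_over C V) : Prop :=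
  forall phi, p phi -> holds phi e.

Definition reduct_params (L' : lang) (L : sublang L') (M : structure L')
    (C : paramset M) : paramset (reduct L M) := fun s => C (sval s).

Definition card_le (A B : Type) : Prop := exists f : A -> B, injective f.
Definition card_lt (A B : Type) : Prop := card_le A B /\ ~ card_le B A.

(* The cardinal kappa is given as the cardinality of a type [K]. *)
Definition small (K : Type) (L : lang) (M : structure L) (C : paramset M) :
    Prop := card_lt {s & params C s} K.

Definition saturated (K : Type) (L : lang) (M : structure L) : Prop :=
  forall (A : paramset M) (n : nat) (sigma : 'I_n -> sort L)
         (p : type_over A (vars sigma)),
    small K A ->
    (forall l : list (formula_over A (vars sigma)),
        (forall phi, List.In phi l -> p phi) ->
        exists a : tuple_of M sigma,
          forall phi, List.In phi l -> holds phi (tup_env a)) ->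
    exists a : tuple_of M sigma, realizes (tup_env a) p.

Definition automorphism (L : lang) (M : structure L)
    (g : forall s, M s -> M s) : Prop :=
  [/\ forall s, bijective (g s),
      forall f a, g _ (fint M f a) = fint M f (fun i => g _ (a i))
    & forall r a, rint M r a <-> rint M r (fun i => g _ (a i))].

Definition partial_elementary (L : lang) (M : structure L) (A : paramset M)
    (h : env (params A) M) : Prop :=
  forall phi : formula (L := L) (params A),
    sat phi (fun s (a : params A s) => sval a) <-> sat phi h.

Definition strongly_homogeneous (K : Type) (L : lang) (M : structure L) : Prop :=
  forall (A : paramset M) (h : env (params A) M),
    small K A -> partial_elementary h ->
    exists2 g : forall s, M s -> M s,
      automorphism g & forall s (a : params A s), g s (sval a) = h s a.

Definition monster (K : Type) (L : lang) (M : structure L) : Prop :=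
  [/\ card_lt nat K, card_lt (sort L + func L + rel L) K,
      saturated K M & strongly_homogeneous K M].

Definition quot (A : Type) (R : A -> A -> Prop) : Type :=
  {P : A -> Prop | exists a, P = R a}.
Definition cls (A : Type) (R : A -> A -> Prop) (a : A) : quot R :=
  exist _ (R a) (ex_intro _ a erefl).

Definition group_law (A : Type) (m : A -> A -> A) : Prop :=
  associative m /\
  exists e, [/\ left_id e m, right_id e m
              & forall x, exists y, m x y = e /\ m y x = e].

Definition group_graph (A : Type) (R : A -> A -> A -> Prop) : Prop :=
  exists2 m, group_law m & forall x y z, R x y z <-> m x y = z.

Definition group_iso (A B : Type) (RA : A -> A -> A -> Prop)
    (RB : B -> B -> B -> Prop) (f : A -> B) : Prop :=
  bijective f /\ forall x y z, RA x y z -> RB (f x) (f y) (f z).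

Definition pair_env (S I J : Type) (M : S -> Type) (sigma : I -> S)
    (tau : J -> S) (a : tuple_of M sigma) (b : tuple_of M tau) :
    env (vsum (vars sigma) (vars tau)) M := sum_env (tup_env a) (tup_env b).

Definition triple_env (S I : Type) (M : S -> Type) (sigma : I -> S)
    (a b c : tuple_of M sigma) :
    env (vsum (vsum (vars sigma) (vars sigma)) (vars sigma)) M :=
  sum_env (pair_env a b) (tup_env c).

(* Only the restriction of [dg_op] to the domain matters, and similarly for
   [hg_eqv] and [hg_op] below: there is no need to require that they imply that
   their arguments lie in the domain. *)
Record def_group (L : lang) (M : structure L) (C : paramset M) : Type := DefGroup {
  dg_arity : nat;
  dg_sort : 'I_dg_arity -> sort L;
  dg_dom : formula_over C (vars dg_sort);
  dg_op : formula_over C (vsum (vsum (vars dg_sort) (vars dg_sort)) (vars dg_sort));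
  dg_set : tuple_of M dg_sort -> Prop := fun a => holds dg_dom (tup_env a);
  dg_graph : sig dg_set -> sig dg_set -> sig dg_set -> Prop :=
    fun a b c => holds dg_op (triple_env (sval a) (sval b) (sval c));
  dg_group : group_graph dg_graph }.
Arguments dg_sort {L M C} d _.
Arguments dg_set {L M C} d _.
Arguments dg_graph {L M C} d _ _ _.

Record hyp_group (L : lang) (M : structure L) (C : paramset M) : Type := HypGroup {
  hg_arity : nat;
  hg_sort : 'I_hg_arity -> sort L;
  hg_dom : type_over C (vars hg_sort);
  hg_eqv : type_over C (vsum (vars hg_sort) (vars hg_sort));
  hg_op : type_over C (vsum (vsum (vars hg_sort) (vars hg_sort)) (vars hg_sort));
  hg_set : tuple_of M hg_sort -> Prop := fun a => realizes (tup_env a) hg_dom;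
  hg_rel : sig hg_set -> sig hg_set -> Prop :=
    fun a b => realizes (pair_env (sval a) (sval b)) hg_eqv;
  hg_pre : sig hg_set -> sig hg_set -> sig hg_set -> Prop :=
    fun a b c => realizes (triple_env (sval a) (sval b) (sval c)) hg_op;
  hg_equiv : Equivalence hg_rel;
  hg_inv1 : forall a a' b c, hg_rel a a' -> hg_pre a b c -> hg_pre a' b c;
  hg_inv2 : forall a b b' c, hg_rel b b' -> hg_pre a b c -> hg_pre a b' c;
  hg_inv3 : forall a b c c', hg_rel c c' -> hg_pre a b c -> hg_pre a b c';
  hg_graph : quot hg_rel -> quot hg_rel -> quot hg_rel -> Prop :=
    fun p q r => exists a b c,
      [/\ cls hg_rel a = p, cls hg_rel b = q, cls hg_rel c = r & hg_pre a b c];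
  hg_group : group_graph hg_graph }.
Arguments hg_sort {L M C} h _.
Arguments hg_set {L M C} h _.
Arguments hg_rel {L M C} h _ _.
Arguments hg_graph {L M C} h _ _ _.

(* [H] lives in [M] and [G] in the reduct of [M]: tuples of the reduct are
   convertible to tuples of [M], which is how [iota] is evaluated on them. *)
Section TypeDefinableIso.
Variables (L' : lang) (L : sublang L') (M : structure L') (C : paramset M).
Variables (H : def_group C) (G : hyp_group (reduct_params (L := L) C)).
Variable iota : type_over C
  (vsum (vars (dg_sort H)) (vars (fun j => sval (hg_sort G j)))).

Definition iota_rel (x : sig (dg_set H)) (y : sig (hg_set G)) : Prop :=
  realizes (pair_env (M := M) (tau := fun j => sval (hg_sort G j))
              (sval x) (sval y)) iota.

Definition type_definable_iso : Prop :=
  (forall x y y', hg_rel G y y' -> iota_rel x y -> iota_rel x y') /\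
  exists2 f : sig (dg_set H) -> quot (hg_rel G),
    group_iso (dg_graph H) (hg_graph G) f &
    forall x q, (exists2 y, cls (hg_rel G) y = q & iota_rel x y) <-> f x = q.
End TypeDefinableIso.

Definition equiv_formula (L : lang) (T : theory L) (n : nat)
    (sigma : 'I_n -> sort L) (E : formula (vsum (vars sigma) (vars sigma))) : Prop :=
  forall M : structure L, models M T ->
    Equivalence (fun a b : tuple_of M sigma => sat E (pair_env a b)).

(* The sorts of L^eq: those of L, and one for every parameter-free L-formula
   which defines an equivalence relation modulo [T]. *)
Inductive eq_sort (L : lang) (T : theory L) : Type :=
  | Real : sort L -> eq_sort T
  | Quot n (sigma : 'I_n -> sort L) (E : formula (vsum (vars sigma) (vars sigma))) :
      equiv_formula T E -> eq_sort T.
Arguments Real {L} T _.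

(* The symbols of L^eq: those of L (on the real sorts), and for every quotient
   sort the projection onto it. *)
Inductive eq_func (L : lang) (T : theory L) : Type :=
  | RealFunc : func L -> eq_func T
  | Proj n (sigma : 'I_n -> sort L) (E : formula (vsum (vars sigma) (vars sigma))) :
      equiv_formula T E -> eq_func T.
Arguments RealFunc {L} T _.

Definition eq_farity (L : lang) (T : theory L) (f : eq_func T) : nat :=
  match f with
  | RealFunc f => farity f
  | Proj n _ _ _ => n
  end.

Definition eq_fdom (L : lang) (T : theory L) (f : eq_func T) :
    'I_(eq_farity f) -> eq_sort T :=
  match f return 'I_(eq_farity f) -> eq_sort T with
  | RealFunc f => fun i => Real T (fdom f i)
  | Proj n sigma _ _ => fun i => Real T (sigma i)
  end.

Arguments eq_fdom {L T} f _.

Definition eq_fcod (L : lang) (T : theory L) (f : eq_func T) : eq_sort T :=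
  match f with
  | RealFunc f => Real T (fcod f)
  | Proj n sigma E hE => Quot hE
  end.

Definition eq_lang (L : lang) (T : theory L) : lang := {|
  sort := eq_sort T;
  func := eq_func T;
  farity := @eq_farity L T;
  fdom := @eq_fdom L T;
  fcod := @eq_fcod L T;
  rel := rel L;
  rarity := @rarity L;
  rdom := fun r i => Real T (rdom r i) |}.

Definition eq_carrier (L : lang) (T : theory L) (M : structure L)
    (e : eq_sort T) : Type :=
  match e with
  | Real s => M s
  | Quot n sigma E _ => quot (fun a b : tuple_of M sigma => sat E (pair_env a b))
  end.

Lemma tuple_inh (L : lang) (M : structure L) n (sigma : 'I_n -> sort L) :
  inhabited (tuple_of M sigma).
Proof.
have [|a _] := @fin_all_exists 'I_n (fun i => M (sigma i)) (fun _ _ => True).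
  by move=> i; have [x] := carrier_inh M (sigma i); exists x.
by split.
Qed.

Lemma eq_carrier_inh (L : lang) (T : theory L) (M : structure L) (e : eq_sort T) :
  inhabited (eq_carrier M e).
Proof.
case: e => [s|n sigma E hE] /=; first exact: carrier_inh.
by have [a] := tuple_inh M sigma; split; exact: cls a.
Qed.

Definition eq_fint (L : lang) (T : theory L) (M : structure L) (f : eq_func T) :
    (forall i, eq_carrier M (eq_fdom f i)) -> eq_carrier M (eq_fcod f) :=
  match f return (forall i, eq_carrier M (eq_fdom f i)) ->
                 eq_carrier M (eq_fcod f) with
  | RealFunc f => fun a => fint M f a
  | Proj n sigma E hE =>
      fun a => cls (fun a b : tuple_of M sigma => sat E (pair_env a b)) a
  end.

(* For M |= T, this is M^eq, a model of T^eq. *)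
Definition eq_structure (L : lang) (T : theory L) (M : structure L) :
    structure (eq_lang T) :=
  @Structure (eq_lang T) (eq_carrier (T := T) M) (eq_carrier_inh (T := T) M)
    (eq_fint (T := T) (M := M)) (fun r a => rint M r a).

Definition eq_params (L : lang) (T : theory L) (M : structure L)
    (C : paramset M) : paramset (eq_structure T M) :=
  fun e => match e return eq_carrier M e -> Prop with
           | Real s => C s
           | Quot _ _ _ _ => fun _ => False
           end.

Definition rep_arity (L : lang) (T : theory L) (e : eq_sort T) : nat :=
  match e with
  | Real _ => 1
  | Quot n _ _ _ => n
  end.

Definition rep_sort (L : lang) (T : theory L) (e : eq_sort T) :
    'I_(rep_arity e) -> sort L :=
  match e return 'I_(rep_arity e) -> sort L with
  | Real s => fun _ => s
  | Quot _ sigma _ _ => sigma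
  end.

Arguments rep_sort {L T} e _.

Definition of_rep (L : lang) (T : theory L) (M : structure L) (e : eq_sort T) :
    tuple_of M (rep_sort e) -> eq_carrier M e :=
  match e return tuple_of M (rep_sort e) -> eq_carrier M e with
  | Real s => fun b => b ord0
  | Quot _ sigma E _ =>
      fun b => cls (fun a b : tuple_of M sigma => sat E (pair_env a b)) b
  end.

(* Sorts of the representatives of a tuple of imaginaries of sorts [tau]. *)
Definition reps_sort (L : lang) (T : theory L) (k : nat)
    (tau : 'I_k -> eq_sort T) (p : {i : 'I_k & 'I_(rep_arity (tau i))}) : sort L :=
  rep_sort (tau (tag p)) (tagged p).

Arguments reps_sort {L T k} tau p.

Definition of_reps (L : lang) (T : theory L) (M : structure L) (k : nat)
    (tau : 'I_k -> eq_sort T) (b : tuple_of M (reps_sort tau)) :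
    tuple_of (eq_structure T M) tau :=
  fun i => of_rep (e := tau i) (fun j => b (existT _ i j)).

(* [iota'] defines over [C] in [M] the pull-back to representatives of the graph
   of an isomorphism from [H] onto [G0]. *)
Section DefinableIso.
Variables (L' : lang) (L : sublang L') (T : theory L).
Variables (M : structure L') (C : paramset M) (H : def_group C).
Variable G0 : def_group (eq_params (T := T) (reduct_params (L := L) C)).

Let rsort (p : {i & 'I_(rep_arity (dg_sort G0 i))}) : sort L' :=
  sval (reps_sort (dg_sort G0) p).

Definition definable_iso
    (iota' : formula_over C (vsum (vars (dg_sort H)) (vars rsort))) : Prop :=
  exists2 f : sig (dg_set H) -> sig (dg_set G0),
    group_iso (dg_graph H) (dg_graph G0) f &
    forall (a : tuple_of M (dg_sort H)) (b : tuple_of M rsort),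
      holds iota' (pair_env a b) <->
      exists ha : dg_set H a,
        sval (f (exist _ a ha)) = of_reps (M := reduct L M) b.

Definition definably_isomorphic : Prop := exists iota', definable_iso iota'.
End DefinableIso.

(* Main.v *)
From mathcomp Require Import all_boot.
From Stdlib Require Import RelationClasses ClassicalEpsilon PropExtensionality.
From Stdlib Require Import FunctionalExtensionality ProofIrrelevance.
Require Import Defs.

(** The isomorphism makes the quotient [Y/F] behave like a definable set, and
    this forces every type involved to be a formula, on a definable set which
    contains [Y].

    The inverse of [iota] is a type-definable function from [Y] onto [X].
    Because [X] is definable, compactness replaces [iota] by one L'(C)-formula
    [delta] which on [Y] has the same graph ([exists_graph]).  Now [F] is an
    L(C)-type which on [Y] is equivalent to an L'(C)-formula, having the same
    [delta]-image, and such a type is equivalent on [Y] to an L(C)-formula [E0]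
    ([separation]); in the same way [Gamma] is equivalent to an L(C)-formula
    [op0].  Each of the finitely many properties that these formulas have on [Y]
    holds, again by compactness, on the solution set of a single L(C)-formula
    [theta] implied by [Y].  So [delta] is a function from [theta] onto [X], its
    fibres are the classes of [E0], and [op0] is the preimage of the group
    operation of [H] ([relatively_definable]).  No element of [theta] outside
    [Y] does any harm: it has the same [delta]-image as some element of [Y].

    Hence [delta] identifies [H] with [theta/E0], and it remains to view the
    latter as a definable set of imaginaries.  The sorts of T^eq are quotients
    by formulas without parameters which are equivalence relations in every
    model, while [E0] has parameters and is an equivalence relation on [theta]
    only.  Both defects disappear if an element [b] of [theta] is represented by
    the tuple [(b, c)], where [c] lists the parameters that occur, and two
    tuples [(b, c)] and [(b', c')] are identified when
    [theta(w, c) /\ E0(b, w, c)] and [theta(w, c') /\ E0(b', w, c')] define the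
    same set of [w] ([exists_imaginary_sort], [exists_code]). *)

Set Implicit Arguments.
Unset Strict Implicit.
Unset Printing Implicit Defensive.

(** * Translations of formulas *)

Lemma env_eq (S : Type) (V W : S -> Type) (e e' : env V W) :
  (forall s v, e s v = e' s v) -> e = e'.
Proof.
move=> H; apply: functional_extensionality_dep => s.
by apply: functional_extensionality_dep => v; apply: H.
Qed.

Fixpoint rename_term (L : lang) (V W : sort L -> Type) (h : env V W)
    (s : sort L) (t : term V s) : term W s :=
  match t in term _ s return term W s with
  | Var s x => Var (h s x)
  | App f args => App f (fun i => rename_term h (args i))
  end.

Fixpoint rename (L : lang) (V : sort L -> Type) (phi : formula V) :
    forall W : sort L -> Type, env V W -> formula W :=
  match phi with
  | Bot => fun W h => Bot
  | Eq s t u => fun W h => Eq (rename_term h t) (rename_term h u)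
  | Rel r args => fun W h => Rel r (fun i => rename_term h (args i))
  | Imp p q => fun W h => Imp (rename p h) (rename q h)
  | All s p =>
      fun W h => All s (rename p (ext_env (fun t v => Old (h t v)) New))
  end.

Lemma tval_rename (L : lang) (M : structure L) (V W : sort L -> Type)
    (h : env V W) (e : env W M) (s : sort L) (t : term V s) :
  tval e (rename_term h t) = tval (fun s v => e s (h s v)) t.
Proof.
elim: t => //= f args IH.
by congr fint; apply: functional_extensionality_dep.
Qed.

Lemma sat_rename (L : lang) (M : structure L) (V : sort L -> Type)
    (phi : formula V) (W : sort L -> Type) (h : env V W) (e : env W M) :
  sat (rename phi h) e <-> sat phi (fun s v => e s (h s v)).
Proof.
elim: phi W h e => {V} [V|V s t u|V r args|V p IHp q IHq|V s p IHp] W h e //=.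
- by rewrite !tval_rename.
- rewrite (_ : (fun i => _) =
    (fun i => tval (fun s v => e s (h s v)) (args i))) //.
  by apply: functional_extensionality_dep => i; apply: tval_rename.
- by move: (IHp _ h e) (IHq _ h e); tauto.
- suff H a : sat (rename p (ext_env (fun t v => Old (h t v)) New)) (ext_env e a)
      <-> sat p (ext_env (fun s v => e s (h s v)) a).
    by split=> Hp a; apply/H.
  rewrite IHp (_ : (fun t v => _) = ext_env (fun s v => e s (h s v)) a) //.
  by apply: env_eq => t [].
Qed.

(** The translation of L-formulas into L^eq, all variables being sent to
    variables of real sorts. *)
Fixpoint real_term (L : lang) (T : theory L) (V : sort L -> Type)
    (W : sort (eq_lang T) -> Type)
    (h : env V (fun s => W (Real T s))) (s : sort L)
    (t : term V s) : term (L := eq_lang T) W (Real T s) :=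
  match t in term _ s return term (L := eq_lang T) W (Real T s) with
  | Var s x => @Var (eq_lang T) W (Real T s) (h s x)
  | App f args =>
      @App (eq_lang T) W (RealFunc T f) (fun i => real_term h (args i))
  end.

Definition real_ext (L : lang) (T : theory L) (V : sort L -> Type)
    (W : sort (eq_lang T) -> Type)
    (h : env V (fun s => W (Real T s))) (s t : sort L)
    (v : ext V s t) : ext W (Real T s) (Real T t) :=
  match v in ext _ _ t return ext W (Real T s) (Real T t) with
  | Old t x => Old (V := W) (h t x)
  | New => New (V := W)
  end.

Fixpoint real_formula (L : lang) (T : theory L) (V : sort L -> Type)
    (phi : formula V) : forall W : sort (eq_lang T) -> Type,
    env V (fun s => W (Real T s)) -> formula (L := eq_lang T) W :=
  match phi with
  | Bot => fun W h => Bot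
  | Eq s t u => fun W h => Eq (real_term h t) (real_term h u)
  | Rel r args =>
      fun W h => @Rel (eq_lang T) W r (fun i => real_term h (args i))
  | Imp p q => fun W h => Imp (real_formula p h) (real_formula q h)
  | All s p => fun W h => @All (eq_lang T) W (Real T s)
      (real_formula p (real_ext h (s := s)))
  end.

Lemma tval_real (L : lang) (T : theory L) (M : structure L) (V : sort L -> Type)
    (W : sort (eq_lang T) -> Type)
    (h : env V (fun s => W (Real T s)))
    (e : env W (eq_structure T M)) (s : sort L) (t : term V s) :
  tval e (real_term h t) = tval (M := M) (fun s v => e (Real T s) (h s v)) t.
Proof.
elim: t => //= f args IH.
by congr fint; apply: functional_extensionality_dep.
Qed.

Lemma sat_real (L : lang) (T : theory L) (M : structure L) (V : sort L -> Type)
    (phi : formula V) (W : sort (eq_lang T) -> Type)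
    (h : env V (fun s => W (Real T s))) (e : env W (eq_structure T M)) :
  sat (real_formula phi h) e <->
  sat (M := M) phi (fun s v => e (Real T s) (h s v)).
Proof.
elim: phi W h e => {V} [V|V s t u|V r args|V p IHp q IHq|V s p IHp] W h e //=.
- by rewrite !tval_real.
- rewrite (_ : (fun i => _) =
    (fun i => tval (M := M) (fun s v => e (Real T s) (h s v)) (args i))) //.
  by apply: functional_extensionality_dep => i; apply: tval_real.
- by move: (IHp _ h e) (IHq _ h e); tauto.
- suff H (a : M s) :
      sat (real_formula p (real_ext h (s := s)))
        (ext_env (M := eq_structure T M) (s := Real T s) e a)
      <-> sat p (ext_env (M := M) (fun s v => e (Real T s) (h s v)) a).
    by split=> Hp a; apply/H.
  rewrite IHp (_ : (fun t v => _) =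
    ext_env (fun s v => e (Real T s) (h s v)) a) //.
  by apply: env_eq => t [].
Qed.

Lemma tval_lift (L' : lang) (L : sublang L') (M : structure L')
    (V : sort L -> Type) (W : sort L' -> Type)
    (h : forall s, V s -> W (sval s)) (e : env W M) (s : sort L)
    (t : term V s) :
  tval e (lift_term h t) =
  tval (M := reduct L M) (fun s v => e (sval s) (h s v)) t.
Proof.
elim: t => //= f args IH.
by congr fint; apply: functional_extensionality_dep.
Qed.

Lemma sat_lift (L' : lang) (L : sublang L') (M : structure L')
    (V : sort L -> Type) (phi : formula V) (W : sort L' -> Type)
    (h : forall s, V s -> W (sval s)) (e : env W M) :
  sat (lift_formula phi h) e <->
  sat (M := reduct L M) phi (fun s v => e (sval s) (h s v)).
Proof.
elim: phi W h e => {V} [V|V s t u|V r args|V p IHp q IHq|V s p IHp] W h e //=.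
- by rewrite !tval_lift.
- rewrite (_ : (fun i => _) = (fun i =>
    tval (M := reduct L M) (fun s v => e (sval s) (h s v)) (args i))) //.
  by apply: functional_extensionality_dep => i; apply: tval_lift.
- by move: (IHp _ h e) (IHq _ h e); tauto.
- suff H (a : M (sval s)) :
      sat (lift_formula p (lift_ext h (s := s))) (ext_env e a)
      <-> sat p (ext_env (M := reduct L M) (fun s v => e (sval s) (h s v)) a).
    by split=> Hp a; apply/H.
  rewrite IHp (_ : (fun t v => _) =
    ext_env (M := reduct L M) (fun s v => e (sval s) (h s v)) a) //.
  by apply: env_eq => t [].
Qed.

Lemma models_reduct (L' : lang) (L : sublang L') (T : theory L) (T' : theory L')
    (M : structure L') :
  subtheory T T' -> models M T' -> models (reduct L M) T.
Proof.
move=> hTT' hM phi /hTT'/hM/sat_lift.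
by rewrite (_ : (fun s v => _) = void_env (reduct L M)).
Qed.

(** * Finite contexts *)

(** Only surjectivity of the enumeration is asked for, which passes to sums and
    disjoint unions at once; [finctx_ord] is the form in which finiteness is
    used. *)
Definition finctx (S : Type) (V : S -> Type) : Prop :=
  exists (I : finType) (sigma : I -> S) (x : tuple_of V sigma),
    forall s (v : V s), exists w : vars sigma s, tup_env x w = v.

Lemma finctx_void (S : Type) : finctx (@void_ctx S).
Proof.
exists void, (fun i : void => match i with end).
by exists (fun i : void => match i with end) => s [].
Qed.

Lemma finctx_vars (S : Type) (I : finType) (sigma : I -> S) :
  finctx (vars sigma).
Proof.
exists I, sigma, (fun i => TVar i) => s v; exists v.
by case: v.
Qed.

Lemma finctx_sum (S : Type) (V W : S -> Type) :
  finctx V -> finctx W -> finctx (vsum V W).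
Proof.
move=> [I [sg [x hx]]] [J [tu [y hy]]].
pose tau k := match k with inl i => sg i | inr j => tu j end.
exists (I + J)%type, tau.
exists (fun k => match k return vsum V W (tau k) with
                 | inl i => inl (x i)
                 | inr j => inr (y j)
                 end).
move=> s [v|v].
- by have [w <-] := hx _ v; case: w => i; exists (TVar (sigma := tau) (inl i)).
- by have [w <-] := hy _ v; case: w => j; exists (TVar (sigma := tau) (inr j)).
Qed.

Lemma finctx_sig (S : Type) (I : finType) (V : I -> S -> Type) :
  (forall i, finctx (V i)) -> finctx (fun s => {i & V i s}).
Proof.
move=> hV.
have [J hJ] := fin_all_exists hV.
have [sg hsg] := fin_all_exists hJ.
have [x hx] := fin_all_exists hsg.
pose tau (k : {i & J i}) := sg (tag k) (tagged k).
exists {i & J i}, tau, (fun k => existT _ (tag k) (x (tag k) (tagged k))).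
move=> s [i v]; have [w <-] := hx i _ v; case: w => j.
by exists (TVar (sigma := tau) (existT _ i j)).
Qed.

(** Every finite context is a retract of a context [vars sigma] indexed by an
    ordinal. *)
Lemma finctx_ord (S : Type) (V : S -> Type) : finctx V ->
  exists n (sigma : 'I_n -> S) (x : tuple_of V sigma) (y : env V (vars sigma)),
    forall s v, tup_env x (y s v) = v.
Proof.
move=> [I [tau [x hx]]].
pose sigma (k : 'I_#|I|) := tau (enum_val k).
have hy s (v : V s) : exists w : vars sigma s,
    tup_env (sigma := sigma) (fun k => x (enum_val k)) w = v.
  have [w <-] := hx _ v; case: w => i /=.
  by rewrite -(enum_rankK i); exists (TVar (sigma := sigma) (enum_rank i)).
exists #|I|, sigma, (fun k => x (enum_val k)).
exists (fun s v => sval (constructive_indefinite_description _ (hy s v))).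
by move=> s v; case: constructive_indefinite_description.
Qed.

Lemma tuple_cons n (P : 'I_n.+1 -> Type) (x : P ord0)
    (y : forall j, P (lift ord0 j)) :
  exists a : forall i, P i, a ord0 = x /\ forall j, a (lift ord0 j) = y j.
Proof.
have [i|a ha] := @fin_all_exists _ P (fun i u =>
    (forall e : ord0 = i, u = ecast k (P k) e x) /\
    (forall j (e : lift ord0 j = i), u = ecast k (P k) e (y j))).
  case: (unliftP ord0 i) => [j|] ->.
  - exists (y j); split=> [e|j' e]; first by case/eqP: (neq_lift ord0 j).
    by have ej := lift_inj e; subst j'; rewrite eq_axiomK.
  - exists x; split=> [e|j e]; first by rewrite eq_axiomK.
    by case/eqP: (neq_lift ord0 j).
exists a; split; first by rewrite (proj1 (ha _) erefl).
by move=> j; rewrite (proj2 (ha _) j erefl).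
Qed.

(** A quantifier over tuples is a string of quantifiers over elements.  The
    first variable is bound by the outermost quantifier, so that the induction
    hypothesis is applied in the context extended by that variable. *)
Lemma all_tuple (L : lang) n (V : sort L -> Type) (sigma : 'I_n -> sort L)
    (phi : formula (vsum V (vars sigma))) :
  exists psi : formula V, forall (M : structure L) (e : env V M),
    sat psi e <-> forall a : tuple_of M sigma, sat phi (sum_env e (tup_env a)).
Proof.
elim: n V sigma phi => [|n IH] V sigma phi.
  have no s (w : vars sigma s) : False by case: w => -[].
  pose h s (v : vsum V (vars sigma) s) : V s :=
    match v with inl x => x | inr w => False_rect _ (no s w) end.
  exists (rename phi h) => M e; rewrite sat_rename.
  have E a : (fun s v => e s (h s v)) = sum_env e (tup_env (sigma := sigma) a).
    by apply: env_eq => s [v|w] //; case: (no s w).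
  split=> [H a|H]; first by rewrite -E.
  have [a] := tuple_inh M sigma.
  by rewrite (E a).
pose s := sigma ord0; pose tau j := sigma (lift ord0 j).
have [x [x0 x1]] := tuple_cons
  (P := fun i => vsum (ext V s) (vars tau) (sigma i)) (inl New)
  (fun j => inr (TVar (sigma := tau) j)).
pose h : env (vsum V (vars sigma)) (vsum (ext V s) (vars tau)) :=
  sum_env (fun s v => inl (Old v)) (tup_env x).
have [psi hpsi] := IH _ _ (rename phi h).
exists (All s psi) => M e /=.
have E (a : tuple_of M sigma) :
    (fun s v => sum_env (ext_env e (a ord0))
       (tup_env (sigma := tau) (fun j => a (lift ord0 j))) (h s v))
    = sum_env e (tup_env a).
  apply: env_eq => t [v|w] //=; case: w => i /=.
  by case: (unliftP ord0 i) => [j|] ->; rewrite ?x0 ?x1.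
split=> H a.
- have /hpsi/(_ (fun j => a (lift ord0 j)))/sat_rename := H (a ord0).
  by rewrite E.
- apply/hpsi => b; apply/sat_rename.
  have [c [c0 c1]] := tuple_cons (P := fun i => M (sigma i)) a b.
  suff -> : b = fun j => c (lift ord0 j) by rewrite -c0 E.
  by apply: functional_extensionality_dep => j; rewrite c1.
Qed.

(** * Formulas use finitely many parameters *)

Lemma term_finite_support (L : lang) (W : sort L -> Type) (s : sort L)
    (t : term W s) (V P : sort L -> Type) (h : env W (vsum V P)) :
  exists (Q : sort L -> Type) (p : env Q P) (u : term (vsum V Q) s), finctx Q /\
    forall (M : structure L) (e : env V M) (r : env P M),
      tval (fun s w => sum_env e r (h s w)) t =
      tval (sum_env e (fun s q => r s (p s q))) u.
Proof.
elim: t => {s} [s w|f args IH].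
- case E: (h s w) => [v|c].
  + exists (@void_ctx (sort L)), (@void_env _ P).
    exists (Var (inl v)); split; first exact: finctx_void.
    by move=> M e r /=; rewrite E.
  + exists (vars (fun i : unit => s)), (tup_env (fun i => c)).
    exists (Var (inr (TVar (sigma := fun i : unit => s) tt))).
    by split; [exact: finctx_vars | move=> M e r /=; rewrite E].
have [Q hQ] := fin_all_exists IH.
have [p hp] := fin_all_exists hQ.
have [u hu] := fin_all_exists hp.
exists (fun s => {i & Q i s}), (fun s q => p (tag q) s (tagged q)).
pose g i : env (vsum V (Q i)) (vsum V (fun s => {i & Q i s})) :=
  fun s v => match v with inl x => inl x | inr q => inr (existT _ i q) end.
exists (App f (fun i => rename_term (g i) (u i))); split.
  by apply: finctx_sig => i; case: (hu i).
move=> M e r /=; congr fint; apply: functional_extensionality_dep => i.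
rewrite tval_rename (proj2 (hu i)); apply: (f_equal (fun E => tval E (u i))).
by apply: env_eq => s [].
Qed.

(** Think of [V] as the variables and of [P] as the names of the parameters: a
    formula mentions finitely many of the latter.  The variables of [phi] are
    sorted into [V] and [P] by an arbitrary [h] because a quantifier adds a
    variable to [W], and the induction must be free to count it in [V]. *)
Lemma finite_support (L : lang) (W : sort L -> Type) (phi : formula W)
    (V P : sort L -> Type) (h : env W (vsum V P)) :
  exists (Q : sort L -> Type) (p : env Q P) (psi : formula (vsum V Q)),
    finctx Q /\
    forall (M : structure L) (e : env V M) (r : env P M),
      sat phi (fun s w => sum_env e r (h s w)) <->
      sat psi (sum_env e (fun s q => r s (p s q))).
Proof.
elim: phi V h => {W} [W|W s t u|W r args|W p1 IH1 p2 IH2|W s p1 IH] V h.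
- exists (@void_ctx (sort L)), (@void_env _ P).
  by exists Bot; split; first exact: finctx_void.
- have [Q1 [p1 [u1 [f1 h1]]]] := term_finite_support t h.
  have [Q2 [p2 [u2 [f2 h2]]]] := term_finite_support u h.
  exists (vsum Q1 Q2), (sum_env p1 p2).
  pose g1 : env (vsum V Q1) (vsum V (vsum Q1 Q2)) :=
    sum_env (fun s v => inl v) (fun s q => inr (inl q)).
  pose g2 : env (vsum V Q2) (vsum V (vsum Q1 Q2)) :=
    sum_env (fun s v => inl v) (fun s q => inr (inr q)).
  exists (Eq (rename_term g1 u1) (rename_term g2 u2)).
  split; first exact: finctx_sum.
  move=> M e r /=; rewrite !tval_rename h1 h2.
  rewrite [X in tval X u1](_ : _ = (fun s v => sum_env e
      (fun s (q : vsum Q1 Q2 s) => r s (sum_env p1 p2 q)) (g1 s v))).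
    2: by apply: env_eq => ? [].
  rewrite [X in tval X u2](_ : _ = (fun s v => sum_env e
      (fun s (q : vsum Q1 Q2 s) => r s (sum_env p1 p2 q)) (g2 s v))).
    2: by apply: env_eq => ? [].
  by [].
- have [Q hQ] := fin_all_exists (fun i => term_finite_support (args i) h).
  have [p hp] := fin_all_exists hQ.
  have [u hu] := fin_all_exists hp.
  exists (fun s => {i & Q i s}), (fun s q => p (tag q) s (tagged q)).
  pose g i : env (vsum V (Q i)) (vsum V (fun s => {i & Q i s})) :=
    fun s v => match v with inl x => inl x | inr q => inr (existT _ i q) end.
  exists (Rel r (fun i => rename_term (g i) (u i))); split.
    by apply: finctx_sig => i; case: (hu i).
  move=> M e c /=; rewrite [X in rint M r X <-> _](_ : _ = (fun i =>
     tval (sum_env e (fun s (q : {i & Q i s}) => c s (p (tag q) s (tagged q))))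
       (rename_term (g i) (u i)))) //.
  apply: functional_extensionality_dep => i.
  rewrite tval_rename (proj2 (hu i)); apply: (f_equal (fun E => tval E (u i))).
  by apply: env_eq => s [].
- have [Q1 [q1 [u1 [f1 h1]]]] := IH1 _ h.
  have [Q2 [q2 [u2 [f2 h2]]]] := IH2 _ h.
  exists (vsum Q1 Q2), (sum_env q1 q2).
  pose g1 : env (vsum V Q1) (vsum V (vsum Q1 Q2)) :=
    sum_env (fun s v => inl v) (fun s q => inr (inl q)).
  pose g2 : env (vsum V Q2) (vsum V (vsum Q1 Q2)) :=
    sum_env (fun s v => inl v) (fun s q => inr (inr q)).
  exists (Imp (rename u1 g1) (rename u2 g2)); split; first exact: finctx_sum.
  move=> M e r /=; rewrite !sat_rename h1 h2.
  rewrite [X in sat u1 X](_ : _ = (fun s v => sum_env e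
      (fun s (q : vsum Q1 Q2 s) => r s (sum_env q1 q2 q)) (g1 s v))).
    2: by apply: env_eq => ? [].
  rewrite [X in sat u2 X](_ : _ = (fun s v => sum_env e
      (fun s (q : vsum Q1 Q2 s) => r s (sum_env q1 q2 q)) (g2 s v))).
    2: by apply: env_eq => ? [].
  by [].
- pose h' : env (ext W s) (vsum (ext V s) P) :=
    ext_env (fun t w => match h t w with
                        | inl v => inl (Old v)
                        | inr c => inr c
                        end) (inl New).
  have [Q [p [u [fQ hu]]]] := IH _ h'.
  pose g : env (vsum (ext V s) Q) (ext (vsum V Q) s) :=
    sum_env (ext_env (fun t v => Old (inl v)) New) (fun t q => Old (inr q)).
  exists Q, p, (All s (rename u g)); split=> // M e r /=.
  suff H a : sat p1 (ext_env (fun t w => sum_env e r (h t w)) a) <->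
     sat (rename u g) (ext_env (sum_env e (fun t q => r t (p t q))) a).
    by split=> Hp a; apply/H.
  rewrite sat_rename.
  rewrite [X in sat u X](_ : _ =
      sum_env (ext_env e a) (fun t q => r t (p t q))).
    2: by apply: env_eq => t [v|//]; case: v.
  rewrite -hu.
  rewrite [X in _ <-> sat p1 X](_ : _ =
    ext_env (fun t w => sum_env e r (h t w)) a) //.
  apply: env_eq => t v; case: v => //= {}t w.
  by case: (h t w).
Qed.

(** * Definable sets and compactness *)

Section Definable.
Variables (L : lang) (M : structure L) (C : paramset M).

(** Definability of a property of the values of the variables, so that formulas
    can be built by proving closure properties. *)
Definition definable (V : sort L -> Type) (D : env V M -> Prop) : Prop :=
  exists phi : formula_over C V, forall e, D e <-> holds phi e.

Lemma definable_rename (V W : sort L -> Type) (D : env W M -> Prop)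
    (g : env V M -> env W M) (h : env W V) :
  (forall e s w, g e s w = e s (h s w)) ->
  definable D -> definable (fun e => D (g e)).
Proof.
move=> hg [phi hphi].
exists (rename phi (sum_env (fun s w => inl (h s w)) (fun s c => inr c))) => e.
rewrite hphi /holds sat_rename.
rewrite [X in sat phi X <-> _](_ : _ = (fun s v => sum_env e
   (fun s (c : params C s) => sval c)
   (sum_env (fun s w => inl (h s w)) (fun s c => inr c) v))) //.
by apply: env_eq => s [w|c]; rewrite /= ?hg.
Qed.

Lemma definable_holds (V W : sort L -> Type) (phi : formula_over C W)
    (g : env V M -> env W M) (h : env W V) :
  (forall e s w, g e s w = e s (h s w)) -> definable (fun e => holds phi (g e)).
Proof. by move=> hg; apply: (definable_rename hg); exists phi. Qed.

Lemma definable_imp (V : sort L -> Type) (D D' : env V M -> Prop) :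
  definable D -> definable D' -> definable (fun e => D e -> D' e).
Proof.
move=> [p hp] [q hq]; exists (Imp p q) => e.
by rewrite /holds /=; move: (hp e) (hq e); rewrite /holds; tauto.
Qed.

Lemma definable_not (V : sort L -> Type) (D : env V M -> Prop) :
  definable D -> definable (fun e => ~ D e).
Proof. by move=> h; apply: definable_imp => //; exists Bot. Qed.

Lemma definable_and (V : sort L -> Type) (D D' : env V M -> Prop) :
  definable D -> definable D' -> definable (fun e => D e /\ D' e).
Proof.
move=> h h'; have [p hp] := definable_not (definable_imp h (definable_not h')).
by exists p => e; rewrite -hp; case: (classic (D e)); tauto.
Qed.

Lemma definable_all n (sigma : 'I_n -> sort L) (V : sort L -> Type)
    (D : env V M -> tuple_of M sigma -> Prop) :
  definable (V := vsum V (vars sigma))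
    (fun e => D (fun s v => e s (inl v)) (fun i => e _ (inr (TVar i)))) ->
  definable (fun e => forall a, D e a).
Proof.
move=> [phi hphi].
pose h : env (vsum (vsum V (vars sigma)) (params C))
    (vsum (vsum V (params C)) (vars sigma)) :=
  sum_env (sum_env (fun s v => inl (inl v)) (fun s w => inr w))
    (fun s c => inl (inr c)).
have [psi hpsi] := all_tuple (rename phi h).
exists psi => e; rewrite /holds hpsi.
suff H a : D e a <-> sat (rename phi h)
    (sum_env (sum_env e (fun s (c : params C s) => sval c)) (tup_env a)).
  by split=> Ha a; apply/H.
rewrite (hphi (sum_env e (tup_env a))) sat_rename /holds.
rewrite [X in sat phi X <-> _](_ : _ = (fun s v =>
  sum_env (sum_env e (fun s (c : params C s) => sval c))
    (tup_env a) (h s v))) //.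
by apply: env_eq => s [[v|v]|v].
Qed.

Lemma definable_ex n (sigma : 'I_n -> sort L) (V : sort L -> Type)
    (D : env V M -> tuple_of M sigma -> Prop) :
  definable (V := vsum V (vars sigma))
    (fun e => D (fun s v => e s (inl v)) (fun i => e _ (inr (TVar i)))) ->
  definable (fun e => exists a, D e a).
Proof.
move=> h; have [|p hp] := definable_not (D := fun e => forall a, ~ D e a).
  by apply: definable_all; apply: definable_not.
exists p => e; rewrite -hp; split=> [[a ha] /(_ a)//|na].
by apply: NNPP => ne; apply: na => a ha; apply: ne; exists a.
Qed.

Lemma definable_list (A : Type) (l : list A) (V : sort L -> Type)
    (D : A -> env V M -> Prop) :
  (forall x, definable (D x)) ->
  definable (fun e => forall x, List.In x l -> D x e).
Proof.
move=> h; elim: l => [|x l IH].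
  by exists (Imp Bot Bot) => e; split=> [_ []|_ x []].
have [p hp] := definable_and (h x) IH; exists p => e; rewrite -hp /=.
split=> [H|[Hx H] y [<-|]//]; first by split=> [|y hy]; apply: H; tauto.
by apply: H.
Qed.

Lemma mem_In (A : eqType) (x : A) (l : seq A) : x \in l -> List.In x l.
Proof.
elim: l => //= y l IH; rewrite inE => /orP[/eqP->|/IH]; first by left.
by right.
Qed.

Lemma definable_tuple_eq n (sigma : 'I_n -> sort L) (V : sort L -> Type)
    (x y : tuple_of V sigma) :
  definable (fun e : env V M =>
    (fun i => e _ (x i)) = (fun i => e _ (y i)) :> tuple_of M sigma).
Proof.
have h i : definable (fun e : env V M => e _ (x i) = e _ (y i)).
  by exists (Eq (Var (inl (x i))) (Var (inl (y i)))).
have [p hp] := definable_list (enum 'I_n) h.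
exists p => e; rewrite -hp; split=> [E i _|H].
  exact: (f_equal (fun a => a i) E).
apply: functional_extensionality_dep => i; apply: H.
by apply: mem_In; rewrite mem_enum.
Qed.

(** Compactness for a downward directed family of definable sets: if their
    intersection lies in a definable set [U], then so does one of them.  The
    type given to saturation consists of all formulas which hold on [D q] minus
    [U] for some [q]; a finite part of it holds on a single such set. *)
Lemma compactness (K : Type) (V : sort L -> Type) (Q : Type) (q0 : Q)
    (D : Q -> env V M -> Prop) (U : env V M -> Prop) :
  saturated K M -> small K C -> finctx V ->
  (forall q, definable (D q)) -> definable U ->
  (forall q q', exists q'', forall e, D q'' e -> D q e /\ D q' e) ->
  (forall e, (forall q, D q e) -> U e) ->
  exists q, forall e, D q e -> U e.
Proof.
move=> hsat hC /finctx_ord [n [sigma [x [y hxy]]]] hD hU dir hDU.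
pose E (a : tuple_of M sigma) : env V M := fun s v => tup_env a (y s v).
have dE F : definable F ->
    definable (V := vars sigma) (fun e => F (fun s v => e s (y s v))).
  exact: definable_rename.
apply: NNPP => hn.
pose p : type_over C (vars sigma) := fun phi =>
  exists q, forall a, D q (E a) -> ~ U (E a) -> holds phi (tup_env a).
have [l hl|a ha] := hsat C n sigma p hC.
  have [q hq] : exists q, forall phi, List.In phi l ->
      forall a, D q (E a) -> ~ U (E a) -> holds phi (tup_env a).
    elim: l hl => [|phi l IH] hl; first by exists q0.
    have [|q1 h1] := IH; first by move=> psi hpsi; apply: hl; right.
    have [q2 h2] := hl phi (or_introl erefl).
    have [q hq] := dir q1 q2; exists q => psi [<-|hpsi] a /hq[Da1 Da2].
      exact: h2.
    exact: h1.
  have [e De Ue] : exists2 e, D q e & ~ U e.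
    apply: NNPP => ne; apply: hn; exists q => e De.
    by apply: NNPP => Ue; apply: ne; exists e.
  exists (fun i => e _ (x i)) => phi hphi.
  have Ee : E (fun i => e _ (x i)) = e.
    apply: env_eq => s v; rewrite /E -[in RHS](hxy s v).
    by case: (y s v).
  by apply: hq; rewrite ?Ee.
have Da q : D q (E a).
  have [phi hphi] := dE _ (hD q).
  apply/(hphi (tup_env a)); apply: ha; exists q => b Db _.
  exact/(hphi (tup_env b)).
have [phi hphi] := dE _ (definable_not hU).
suff: ~ U (E a) by apply; apply: hDU.
apply/(hphi (tup_env a)); apply: ha; exists q0 => b _ Ub.
exact/(hphi (tup_env b)).
Qed.

End Definable.

Lemma definable_lift (L' : lang) (L : sublang L') (M : structure L')
    (C : paramset M) (V : sort L' -> Type) (W : sort L -> Type)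
    (phi : formula_over (reduct_params (L := L) C) W)
    (g : env V M -> env W (reduct L M)) (h : env W (fun s => V (sval s))) :
  (forall e s w, g e s w = e (sval s) (h s w)) ->
  definable C (fun e => holds phi (g e)).
Proof.
move=> hg.
pose h' s (v : vsum W (params (reduct_params C)) s) :
    vsum V (params C) (sval s) :=
  match v with inl w => inl (h s w) | inr c => inr c end.
exists (lift_formula phi h') => e; rewrite /holds sat_lift.
rewrite [X in sat phi X <-> _](_ : _ = (fun s v => sum_env e
   (fun s (c : params C s) => sval c) (h' s v))) //.
by apply: env_eq => s [w|c]; rewrite /= ?hg.
Qed.

Lemma definable_real (L : lang) (T : theory L) (M : structure L)
    (C : paramset M) (V : sort (eq_lang T) -> Type) (W : sort L -> Type)
    (phi : formula_over C W)
    (g : env V (eq_structure T M) -> env W M)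
    (h : env W (fun s => V (Real T s : sort (eq_lang T)))) :
  (forall e s w, g e s w = e (Real T s) (h s w)) ->
  definable (eq_params (T := T) C) (fun e => holds phi (g e)).
Proof.
move=> hg.
pose C' := eq_params (T := T) C.
pose h' : env (vsum W (params C)) (fun s => vsum V (params C') (Real T s)) :=
  fun s v => match v with inl w => inl (h s w) | inr c => inr c end.
exists (real_formula phi h') => e; rewrite /holds sat_real.
rewrite [X in sat phi X <-> _](_ : _ = (fun s v => sum_env e
   (fun s (c : params C' s) => sval c) (h' s v))) //.
by apply: env_eq => s [w|c]; rewrite /= ?hg.
Qed.

(** The consequences of a type are closed under conjunction and have the same
    realizations as the type: they turn it into a directed family, as
    [compactness] requires. *)
Definition consequence (L : lang) (M : structure L) (C : paramset M)
    (V : sort L -> Type) (p : type_over C V) (phi : formula_over C V) : Prop :=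
  forall e, realizes e p -> holds phi e.

Definition And (L : lang) (V : sort L -> Type) (p q : formula V) : formula V :=
  Neg (Imp p (Neg q)).

Lemma holds_And (L : lang) (M : structure L) (C : paramset M)
    (V : sort L -> Type) (p q : formula_over C V) (e : env V M) :
  holds (And p q) e <-> holds p e /\ holds q e.
Proof.
by rewrite /holds /=; split=> [H|[? ?]]; [split; apply: NNPP|]; tauto.
Qed.

Lemma consequence_And (L : lang) (M : structure L) (C : paramset M)
    (V : sort L -> Type) (r : type_over C V) (p q : formula_over C V) :
  consequence r p -> consequence r q -> consequence r (And p q).
Proof. by move=> hp hq e he; apply/holds_And; split; [exact: hp|exact: hq]. Qed.

Lemma consequence_in (L : lang) (M : structure L) (C : paramset M)
    (V : sort L -> Type) (r : type_over C V) (p : formula_over C V) :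
  r p -> consequence r p.
Proof. by move=> rp e he; apply: he. Qed.

Lemma consequence_top (L : lang) (M : structure L) (C : paramset M)
    (V : sort L -> Type) (r : type_over C V) : consequence r (Imp Bot Bot).
Proof. by move=> e _. Qed.
Arguments consequence_top {L M C V} r e _.

(** * Types that are equivalent to formulas *)

(** Suppose that [p] is an L(C)-type and [U] an L'(C)-definable set, and that
    the two agree as soon as the subtuples listed in [cs] realize [q].  Then some
    L(C)-formula [phi] agrees with [U] as soon as these subtuples satisfy a
    single consequence of [q].  Indeed [q] and [p] imply [U], so a consequence
    [phi] of [p] does too; then [q] and [U] imply [p], hence [phi], and
    compactness applies to [q] once more. *)
Lemma separation (K : Type) (L' : lang) (L : sublang L') (M : structure L')
    (C : paramset M) (V W : sort L -> Type) (V' : sort L' -> Type)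
    (h : env V (fun s => V' (sval s))) (cs : seq (env W V))
    (q : type_over (reduct_params (L := L) C) W)
    (p : type_over (reduct_params (L := L) C) V) (U : env V' M -> Prop) :
  saturated K M -> small K C -> finctx V' -> definable C U ->
  let red (e : env V' M) : env V (reduct L M) :=
    fun s v => e (sval s) (h s v) in
  (forall e,
     (forall x, List.In x cs -> realizes (fun s w => red e s (x s w)) q) ->
     realizes (red e) p <-> U e) ->
  exists2 theta, consequence q theta &
    exists phi : formula_over (reduct_params (L := L) C) V, forall e,
      (forall x, List.In x cs -> holds theta (fun s w => red e s (x s w))) ->
      holds phi (red e) <-> U e.
Proof.
move=> hsat hC hV hU red H.
have dphi (phi : formula_over (reduct_params (L := L) C) V) :
    definable C (fun e : env V' M => holds phi (red e)).
  exact: (definable_lift phi (g := red) (h := h)).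
have dtheta (theta : formula_over (reduct_params (L := L) C) W) :
    definable C (fun e =>
      forall x, List.In x cs -> holds theta (fun s w => red e s (x s w))).
  apply: definable_list => x.
  by apply: (definable_lift theta (g := fun e s w => red e s (x s w))
    (h := fun s w => h s (x s w))).
have [|||[[th1 c1] [phi cphi]] /= h1] := @compactness _ _ _ K V'
  ({th | consequence q th} * {phi | consequence p phi})
  (exist _ _ (consequence_top q), exist _ _ (consequence_top p))
  (fun k e =>
     (forall x, List.In x cs -> holds (sval k.1) (fun s w => red e s (x s w)))
     /\ holds (sval k.2) (red e)) U hsat hC hV _ hU.
- by move=> k; apply: definable_and.
- move=> [[t1 k1] [ph1 g1]] [[t2 k2] [ph2 g2]].
  exists (exist _ _ (consequence_And k1 k2), exist _ _ (consequence_And g1 g2)).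
  move=> e /= [ht /holds_And[? ?]].
  by split; split=> // x /ht /holds_And[].
- move=> e he; apply/H => [x xcs ph qph|ph pph].
  + by have [/(_ x xcs)] :=
      he (exist _ _ (consequence_in qph), exist _ _ (consequence_top p)).
  + by have [_] :=
      he (exist _ _ (consequence_top q), exist _ _ (consequence_in pph)).
have [|||[th2 c2] /= h2] := @compactness _ _ _ K V'
  {th | consequence q th} (exist _ _ (consequence_top q))
  (fun k e =>
     (forall x, List.In x cs -> holds (sval k) (fun s w => red e s (x s w)))
     /\ U e) (fun e => holds phi (red e)) hsat hC hV _ (dphi phi).
- by move=> k; apply: definable_and.
- move=> [t1 k1] [t2 k2].
  exists (exist _ _ (consequence_And k1 k2)) => e /= [ht ?].
  by split; split=> // x /ht /holds_And[].
- move=> e he; apply: cphi; apply/H => [x xcs ph qph|].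
  + by have [/(_ x xcs)] := he (exist _ _ (consequence_in qph)).
  + by have [] := he (exist _ _ (consequence_top q)).
exists (And th1 th2); first exact: consequence_And.
exists phi => e he; split=> [he'|Ue].
- by apply: h1; split=> // x /he /holds_And[].
- by apply: h2; split=> // x /he /holds_And[].
Qed.

(** * Formulas defining the group on representatives *)

Lemma cls_eq (A : Type) (R : A -> A -> Prop) (a b : A) :
  Equivalence R -> cls R a = cls R b <-> R a b.
Proof.
move=> [rR sR tR]; split=> [[E]|ab].
  by rewrite E; apply: rR.
suff E : R a = R b.
  rewrite /cls; move: (ex_intro _ a _); rewrite E => ?.
  by congr exist; apply: proof_irrelevance.
apply: functional_extensionality_dep => c; apply: propositional_extensionality.
by split; [apply: tR; apply: sR|apply: tR].
Qed.

Lemma sig_eq (A : Type) (P : A -> Prop) (u v : sig P) :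
  sval u = sval v -> u = v.
Proof.
case: u v => [a Pa] [b Pb] /= E; subst b.
by congr exist; apply: proof_irrelevance.
Qed.

Section Tuples.
Variables (L : lang) (M : structure L) (C : paramset M).
Variables (n : nat) (sigma : 'I_n -> sort L).

Definition holds1 (phi : formula_over C (vars sigma)) (a : tuple_of M sigma) :
    Prop :=
  holds phi (tup_env a).

Definition holds2 (phi : formula_over C (vsum (vars sigma) (vars sigma)))
    (a b : tuple_of M sigma) : Prop :=
  holds phi (pair_env a b).

Definition holds3
    (phi : formula_over C (vsum (vsum (vars sigma) (vars sigma)) (vars sigma)))
    (a b c : tuple_of M sigma) : Prop :=
  holds phi (triple_env a b c).

Lemma holds1_And p q a : holds1 (And p q) a <-> holds1 p a /\ holds1 q a.
Proof. exact: holds_And. Qed.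

End Tuples.

Section Isomorphism.
Variables (L' : lang) (L : sublang L') (M : structure L') (C : paramset M).
Variables (H : def_group C) (G : hyp_group (reduct_params (L := L) C)).
Variable iota : type_over C
  (vsum (vars (dg_sort H)) (vars (fun j => sval (hg_sort G j)))).
Hypothesis hiota : type_definable_iso iota.

Let rho := dg_sort H.
Let sigma := hg_sort G.
Let sigma' := fun j => sval (sigma j).
Let X := dg_set H.
Let Y (y : tuple_of M sigma') : Prop := hg_set G y.
Let R (x : tuple_of M rho) (y : tuple_of M sigma') : Prop :=
  realizes (pair_env x y) iota.
Let op (x1 x2 x3 : tuple_of M rho) : Prop :=
  holds (dg_op H) (triple_env x1 x2 x3).

Lemma iota_inj x x' y : X x -> X x' -> Y y -> R x y -> R x' y -> x = x'.
Proof.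
case: hiota => _ [f [[g fK gK] hf] hR] hx hx' hy r r'.
suff: exist X x hx = exist X x' hx' by move=> [].
apply: (can_inj fK).
pose z := exist (hg_set G) y hy.
have -> : f (exist X x hx) = cls (hg_rel G) z by apply/hR; exists z.
by apply/esym/hR; exists z.
Qed.

Lemma iota_surj y : Y y -> exists2 x, X x & R x y.
Proof.
case: hiota => inv [f [[g fK gK] hf] hR] hy.
pose q := cls (hg_rel G) (exist _ y hy).
have [z zq rz] := proj2 (hR (g q) q) (gK q).
exists (sval (g q)); first exact: svalP.
have zy : hg_rel G z (exist _ y hy) by apply/(cls_eq _ _ (hg_equiv G)).
exact: inv zy rz.
Qed.

Lemma iota_total x : X x -> exists2 y, Y y & R x y.
Proof.
case: hiota => inv [f [[g fK gK] hf] hR] hx.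
have [z zq rz] := proj2 (hR (exist X x hx) _) erefl.
by exists (sval z); first exact: svalP.
Qed.

Lemma iota_eqv y y' : Y y -> Y y' ->
  realizes (pair_env (M := reduct L M) y y') (@hg_eqv _ _ _ G) <->
  exists x, (X x /\ R x y) /\ (X x /\ R x y').
Proof.
move=> hy hy'; case: (hiota) => inv [f [fbij hf] hR].
split=> [E|[x [[hx r] [_ r']]]].
- have [x hx r] := iota_surj hy; exists x; split=> //; split=> //.
  exact: (inv (exist _ x hx) (exist _ y hy) (exist _ y' hy') E r).
- pose x1 := exist X x hx.
  pose z := exist (hg_set G) y hy; pose z' := exist (hg_set G) y' hy'.
  suff: hg_rel G z z' by [].
  apply/(cls_eq _ _ (hg_equiv G)).
  have <- : f x1 = cls (hg_rel G) z by apply/hR; exists z.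
  by apply/hR; exists z'.
Qed.

(** A homomorphism between graphs of total operations that is injective also
    reflects the graph; this gives the implication from left to right. *)
Lemma iota_op y1 y2 y3 : Y y1 -> Y y2 -> Y y3 ->
  realizes (triple_env (M := reduct L M) y1 y2 y3) (@hg_op _ _ _ G) <->
  exists x1 x2 x3,
    [/\ X x1 /\ R x1 y1, X x2 /\ R x2 y2, X x3 /\ R x3 y3 & op x1 x2 x3].
Proof.
move=> h1 h2 h3; case: (hiota) => inv [f [[g fK gK] hf] hR].
pose z1 := exist (hg_set G) y1 h1; pose z2 := exist (hg_set G) y2 h2.
pose z3 := exist (hg_set G) y3 h3.
have fE x z (hx : X x) : R x (sval z) -> f (exist X x hx) = cls (hg_rel G) z.
  by move=> r; apply/hR; exists z.
have -> : realizes (triple_env (M := reduct L M) y1 y2 y3) (@hg_op _ _ _ G) <->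
    hg_graph G (cls _ z1) (cls _ z2) (cls _ z3).
  split=> [r|[w1 [w2 [w3 [/(cls_eq _ _ (hg_equiv G)) e1
    /(cls_eq _ _ (hg_equiv G)) e2 /(cls_eq _ _ (hg_equiv G)) e3 r]]]]].
    by exists z1, z2, z3.
  exact: (hg_inv3 e3 (hg_inv2 e2 (hg_inv1 e1 r))).
split=> [r|[x1 [x2 [x3 [[hx1 r1] [hx2 r2] [hx3 r3] o]]]]].
- have [x1 hx1 r1] := iota_surj h1; have [x2 hx2 r2] := iota_surj h2.
  have [x3 hx3 r3] := iota_surj h3.
  exists x1, x2, x3; split=> //.
  have [m _ hm] := dg_group H; have [m' _ hm'] := hg_group G.
  have o := proj2 (hm (exist X x1 hx1) (exist X x2 hx2) _) erefl.
  have := hf _ _ _ o.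
  rewrite (fE x1 z1 hx1 r1) (fE x2 z2 hx2 r2) => /hm' E.
  move/hm': r; rewrite E -(fE x3 z3 hx3 r3) => /(can_inj fK) E3.
  by move: o; rewrite E3.
- rewrite -(fE x1 z1 hx1 r1) -(fE x2 z2 hx2 r2) -(fE x3 z3 hx3 r3).
  exact: hf.
Qed.

Variable K : Type.
Hypotheses (hsat : saturated K M) (hC : small K C).

Let Graph (delta : formula_over C (vsum (vars rho) (vars sigma')))
    (x : tuple_of M rho) (y : tuple_of M sigma') : Prop :=
  X x /\ holds delta (pair_env x y).

Let definable_theta (V : sort L' -> Type)
    (theta : formula_over (reduct_params (L := L) C) (vars sigma))
    (y : tuple_of V sigma') :
  definable C (fun e : env V M => holds1 theta (fun i => e _ (y i))).
Proof.
apply: (definable_lift theta (g := fun e =>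
    tup_env (M := reduct L M) (sigma := sigma) (fun i => e _ (y i)))
  (h := tup_env (M := fun s => V (sval s)) y)).
by move=> e s; case.
Qed.

Let definable_X (V : sort L' -> Type) (x : tuple_of V rho) :
  definable C (fun e : env V M => X (fun i => e _ (x i))).
Proof. by apply: (definable_holds _ (h := tup_env x)) => e s; case. Qed.

Let definable_op (V : sort L' -> Type) (x1 x2 x3 : tuple_of V rho) :
  definable C (fun e : env V M =>
    op (fun i => e _ (x1 i)) (fun i => e _ (x2 i)) (fun i => e _ (x3 i))).
Proof.
by apply: (definable_holds _ (h := triple_env x1 x2 x3)) => e s; do 3?case.
Qed.

Let definable_graph (V : sort L' -> Type)
    (delta : formula_over C (vsum (vars rho) (vars sigma')))
    (x : tuple_of V rho) (y : tuple_of V sigma') :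
  definable C (fun e : env V M =>
    Graph delta (fun i => e _ (x i)) (fun i => e _ (y i))).
Proof.
apply: definable_and; first exact: definable_X.
by apply: (definable_holds _ (h := pair_env x y)) => e s; case; case.
Qed.

Let consequence_holds theta y :
  consequence (@hg_dom _ _ _ G) theta -> Y y -> holds1 theta y.
Proof. by move=> h hy; apply: h. Qed.

(** Distinct elements of [X] are never related by [iota] to the same element of
    [Y].  As equality on [X] is a formula, this needs only finitely many formulas
    of [iota] and of [Y], and their conjunctions are [delta] and [theta]. *)
Lemma exists_graph : exists2 theta, consequence (@hg_dom _ _ _ G) theta &
  exists2 delta, consequence iota delta &
    forall x x' y, holds1 theta y ->
      Graph delta x y -> Graph delta x' y -> x = x'.
Proof.
pose V := vsum (vsum (vars rho) (vars rho)) (vars sigma').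
pose x (e : env V M) : tuple_of M rho := fun i => e _ (inl (inl (TVar i))).
pose x' (e : env V M) : tuple_of M rho := fun i => e _ (inl (inr (TVar i))).
pose y (e : env V M) : tuple_of M sigma' := fun j => e _ (inr (TVar j)).
have [|||||[[theta cth] [delta cd]] /= h] := @compactness _ _ C K V
  ({th | consequence (@hg_dom _ _ _ G) th} * {d | consequence iota d})
  (exist _ _ (consequence_top _), exist _ _ (consequence_top _))
  (fun k e => holds1 (sval k.1) (y e) /\
     Graph (sval k.2) (x e) (y e) /\ Graph (sval k.2) (x' e) (y e))
  (fun e => x e = x' e) hsat hC.
- by apply: finctx_sum; [apply: finctx_sum|]; apply: finctx_vars.
- move=> [[th ?] [d ?]] /=.
  apply: definable_and; first exact: definable_theta.
  by apply: definable_and; exact: definable_graph.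
- exact: definable_tuple_eq.
- move=> [[t1 k1] [d1 g1]] [[t2 k2] [d2 g2]].
  exists (exist _ _ (consequence_And k1 k2), exist _ _ (consequence_And g1 g2)).
  by move=> e /= [/holds_And[? ?] [[? /holds_And[? ?]] [? /holds_And[? ?]]]].
- move=> e he.
  have [_ [[hx _] [hx' _]]] :=
    he (exist _ _ (consequence_top _), exist _ _ (consequence_top _)).
  apply: (@iota_inj _ _ (y e)) => // phi hphi.
  + by have [] :=
      he (exist _ _ (consequence_in hphi), exist _ _ (consequence_top _)).
  + by have [_ [[_ ?] _]] :=
      he (exist _ _ (consequence_top _), exist _ _ (consequence_in hphi)).
  + by have [_ [_ [_ ?]]] :=
      he (exist _ _ (consequence_top _), exist _ _ (consequence_in hphi)).
exists theta => //; exists delta => // a a' b hb ha ha'.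
exact: (h (sum_env (pair_env a a') (tup_env (sigma := sigma') b))).
Qed.

(** On [theta], which contains [Y], the formula [delta] is the graph of a
    function onto [X]; [E0] and [op0] are the preimages under it of equality and
    of the group operation.  [Y] itself has disappeared. *)
Lemma relatively_definable : exists
    (theta : formula_over (reduct_params C) (vars sigma))
    (delta : formula_over C (vsum (vars rho) (vars sigma')))
    (E0 : formula_over (reduct_params C) (vsum (vars sigma) (vars sigma)))
    (op0 : formula_over (reduct_params C)
             (vsum (vsum (vars sigma) (vars sigma)) (vars sigma))),
  [/\ forall y, holds1 theta y -> exists x, Graph delta x y,
      forall x x' y, holds1 theta y ->
        Graph delta x y -> Graph delta x' y -> x = x',
      forall x, X x -> exists2 y, holds1 theta y & Graph delta x y,
      forall y y', holds1 theta y -> holds1 theta y' ->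
        holds2 E0 y y' <-> exists x, Graph delta x y /\ Graph delta x y'
    & forall y1 y2 y3, holds1 theta y1 -> holds1 theta y2 -> holds1 theta y3 ->
        holds3 op0 y1 y2 y3 <->
        exists x1 x2 x3,
          [/\ Graph delta x1 y1, Graph delta x2 y2, Graph delta x3 y3
             & op x1 x2 x3]].
Proof.
have [th0 c0 [delta cd inj]] := exists_graph.
(* An element of [Y] is already related to something by [iota], so [delta] cannot
   relate it to anything else. *)
have DR x y : Y y -> Graph delta x y <-> X x /\ R x y.
  move=> hy; split=> [d|[hx r]]; last by split=> //; apply: cd.
  have [x' hx' r'] := iota_surj hy.
  suff -> : x = x' by [].
  apply: (inj _ _ y) => //; first exact: consequence_holds.
  by split=> //; apply: cd.
have [||||| [th1 c1] /= h1] := @compactness _ _ C K (vars sigma')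
  {th | consequence (@hg_dom _ _ _ G) th} (exist _ _ (consequence_top _))
  (fun k e => holds1 (sval k) (fun i => e _ (TVar i)))
  (fun e => exists x, Graph delta x (fun i => e _ (TVar i))) hsat hC.
- exact: finctx_vars.
- by move=> k; apply: definable_theta.
- by apply: definable_ex; apply: definable_graph.
- move=> [t1 k1] [t2 k2].
  by exists (exist _ _ (consequence_And k1 k2)) => e /= /holds1_And[].
- move=> e he; pose y : tuple_of M sigma' := fun i => e _ (TVar i).
  have hy : Y y by move=> ph hph; apply: (he (exist _ _ (consequence_in hph))).
  by have [x hx r] := iota_surj hy; exists x; apply/DR.
have [th2 c2 [E0 h2]] : exists2 th2, consequence (@hg_dom _ _ _ G) th2 &
    exists E0 : formula_over (reduct_params C) (vsum (vars sigma) (vars sigma)),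
    forall y y', holds1 th2 y -> holds1 th2 y' ->
      holds2 E0 y y' <->
      exists x, Graph delta x y /\ Graph delta x y'.
  pose V' := vsum (vars sigma') (vars sigma').
  pose v1 i : V' (sigma' i) := inl (TVar i).
  pose v2 i : V' (sigma' i) := inr (TVar i).
  pose h := pair_env (M := fun s => V' (sval s)) (sigma := sigma) (tau := sigma)
    v1 v2.
  have redE (e : env V' M) : (fun s v => e (sval s) (h s v)) =
      pair_env (M := reduct L M) (sigma := sigma) (tau := sigma)
        (fun i => e _ (v1 i)) (fun i => e _ (v2 i)).
    by apply: env_eq => s; do 2!case.
  pose cs : seq (env (vars sigma) (vsum (vars sigma) (vars sigma))) :=
    [:: fun s w => inl w; fun s w => inr w].
  have [|||th cth [E0 hE]] := @separation K L' L M C _ _ V' h cs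
    (@hg_dom _ _ _ G) (@hg_eqv _ _ _ G)
    (fun e => exists x, Graph delta x (fun i => e _ (v1 i)) /\
                        Graph delta x (fun i => e _ (v2 i)))
    hsat hC.
  - by apply: finctx_sum; apply: finctx_vars.
  - by apply: definable_ex; apply: definable_and; apply: definable_graph.
  - move=> e; rewrite redE => he.
    have he' x : List.In x cs -> realizes (fun s w =>
        pair_env (M := reduct L M) (sigma := sigma) (tau := sigma)
          (fun i => e _ (v1 i)) (fun i => e _ (v2 i)) (x s w))
        (@hg_dom _ _ _ G).
      by move=> /he; rewrite -(redE e).
    have hy1 : Y (fun i => e _ (v1 i)) := he' _ (or_introl erefl).
    have hy2 : Y (fun i => e _ (v2 i)) := he' _ (or_intror (or_introl erefl)).
    rewrite iota_eqv //.
    by split=> -[x]; rewrite -?DR // => hx; exists x; move: hx; rewrite ?DR.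
  exists th => //; exists E0 => y y' hy hy'.
  pose e : env V' M := pair_env (M := M) (sigma := sigma') (tau := sigma') y y'.
  have he x : List.In x cs -> holds th (fun s w => e (sval s) (h s (x s w))).
    move=> hx; suff: holds th (fun s w =>
        pair_env (M := reduct L M) (sigma := sigma) (tau := sigma)
          (fun i => e _ (v1 i)) (fun i => e _ (v2 i)) (x s w)).
      by rewrite -(redE e).
    by case: hx => [<-|[<-|[]]].
  by have := hE e he; rewrite redE.
have [th3 c3 [op0 h3]] : exists2 th3, consequence (@hg_dom _ _ _ G) th3 &
    exists op0 : formula_over (reduct_params C)
      (vsum (vsum (vars sigma) (vars sigma)) (vars sigma)),
    forall y1 y2 y3, holds1 th3 y1 -> holds1 th3 y2 -> holds1 th3 y3 ->
      holds3 op0 y1 y2 y3 <->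
      exists x1 x2 x3,
        [/\ Graph delta x1 y1, Graph delta x2 y2, Graph delta x3 y3
           & op x1 x2 x3].
  pose V' := vsum (vsum (vars sigma') (vars sigma')) (vars sigma').
  pose v1 i : V' (sigma' i) := inl (inl (TVar i)).
  pose v2 i : V' (sigma' i) := inl (inr (TVar i)).
  pose v3 i : V' (sigma' i) := inr (TVar i).
  pose h := triple_env (M := fun s => V' (sval s)) (sigma := sigma) v1 v2 v3.
  have redE (e : env V' M) : (fun s v => e (sval s) (h s v)) =
      triple_env (M := reduct L M) (sigma := sigma)
        (fun i => e _ (v1 i)) (fun i => e _ (v2 i)) (fun i => e _ (v3 i)).
    by apply: env_eq => s; do 3?case.
  pose cs : seq (env (vars sigma)
      (vsum (vsum (vars sigma) (vars sigma)) (vars sigma))) :=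
    [:: fun s w => inl (inl w); fun s w => inl (inr w); fun s w => inr w].
  have [|||th cth [op0 hE]] := @separation K L' L M C _ _ V' h cs
    (@hg_dom _ _ _ G) (@hg_op _ _ _ G)
    (fun e => exists x1 x2 x3,
       (Graph delta x1 (fun i => e _ (v1 i)) /\
        Graph delta x2 (fun i => e _ (v2 i))) /\
       (Graph delta x3 (fun i => e _ (v3 i)) /\ op x1 x2 x3))
    hsat hC.
  - by do ![apply: finctx_sum]; apply: finctx_vars.
  - do 3![apply: definable_ex]; apply: definable_and.
      by apply: definable_and; exact: definable_graph.
    apply: definable_and; first exact: definable_graph.
    exact: definable_op.
  - move=> e; rewrite redE => he.
    have he' x : List.In x cs -> realizes (fun s w =>
        triple_env (M := reduct L M) (sigma := sigma)
          (fun i => e _ (v1 i)) (fun i => e _ (v2 i))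
        (fun i => e _ (v3 i)) (x s w)) (@hg_dom _ _ _ G).
      by move=> /he; rewrite -(redE e).
    have hy1 : Y (fun i => e _ (v1 i)) := he' _ (or_introl erefl).
    have hy2 : Y (fun i => e _ (v2 i)) := he' _ (or_intror (or_introl erefl)).
    have hy3 : Y (fun i => e _ (v3 i)).
      exact: he' _ (or_intror (or_intror (or_introl erefl))).
    rewrite iota_op //.
    split=> -[x1 [x2 [x3]]].
      case=> /(DR _ _ hy1) ? /(DR _ _ hy2) ? /(DR _ _ hy3) ? ?.
      by exists x1, x2, x3.
    case=> -[/(DR _ _ hy1) ? /(DR _ _ hy2) ?] [/(DR _ _ hy3) ? ?].
    by exists x1, x2, x3.
  exists th => //; exists op0 => y1 y2 y3 hy1 hy2 hy3.
  pose e : env V' M := triple_env (M := M) (sigma := sigma') y1 y2 y3.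
  have he x : List.In x cs -> holds th (fun s w => e (sval s) (h s (x s w))).
    move=> hx; suff: holds th (fun s w =>
        triple_env (M := reduct L M) (sigma := sigma) (fun i => e _ (v1 i))
          (fun i => e _ (v2 i)) (fun i => e _ (v3 i)) (x s w)).
      by rewrite -(redE e).
    by case: hx => [<-|[<-|[<-|[]]]].
  have := hE e he; rewrite redE => H'; apply: (iff_trans H').
  split=> -[x1 [x2 [x3]]]; last by case=> *; exists x1, x2, x3.
  by case=> -[? ?] []; exists x1, x2, x3.
exists (And (And th0 th1) (And th2 th3)), delta, E0, op0.
split.
- move=> y /holds1_And[/holds1_And[? ?] _].
  exact: (h1 (tup_env (M := M) (sigma := sigma') y)).
- by move=> x x' y /holds1_And[/holds1_And[? ?] _]; apply: inj.
- move=> x hx; have [y hy r] := iota_total hx; exists y; last by apply/DR.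
  by apply: consequence_holds => //; do ![apply: consequence_And].
- move=> y y' /holds1_And[_ /holds1_And[? _]] /holds1_And[_ /holds1_And[? _]].
  exact: h2.
- move=> y1 y2 y3 /holds1_And[_ /holds1_And[_ ?]].
  move=> /holds1_And[_ /holds1_And[_ ?]] /holds1_And[_ /holds1_And[_ ?]].
  exact: h3.
Qed.

End Isomorphism.

(** * Imaginaries *)

Lemma equivalence_of_code (A B : Type) (R : A -> A -> Prop)
    (P : A -> B -> Prop) :
  (forall a b, R a b <-> forall w, P a w <-> P b w) -> Equivalence R.
Proof.
move=> hR; split=> [a|a b /hR ab|a b c /hR ab /hR bc]; apply/hR => w //.
  by rewrite ab.
by rewrite ab bc.
Qed.

(** The tuple [x] lists the variables of [b] and the parameters [r] as the
    coordinates of one tuple.  Two such tuples are identified when [psi] defines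
    the same set of [w] from both: a relation of this shape is an equivalence
    relation in every structure, whatever [psi] is. *)
Lemma exists_imaginary_sort (L : lang) (T : theory L) n (sigma : 'I_n -> sort L)
    (Q : sort L -> Type)
    (psi : formula (vsum (vsum (vars sigma) (vars sigma)) Q)) :
  finctx Q ->
  exists k (tau : 'I_k -> sort L) (x : tuple_of (vsum (vars sigma) Q) tau)
      (E : formula (vsum (vars tau) (vars tau))),
    equiv_formula T E /\
    forall (M : structure L) (b b' : tuple_of M sigma) (r : env Q M),
      sat E (pair_env (fun i => sum_env (tup_env b) r (x i))
                      (fun i => sum_env (tup_env b') r (x i))) <->
      forall w : tuple_of M sigma,
        sat psi (sum_env (pair_env b w) r) <->
        sat psi (sum_env (pair_env b' w) r).
Proof.
move=> hQ.
have [k [tau [x [y hxy]]]] := finctx_ord (finctx_sum (finctx_vars sigma) hQ).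
pose g (u : env (vars tau) (vsum (vars tau) (vars tau))) :
    env (vsum (vsum (vars sigma) (vars sigma)) Q)
        (vsum (vsum (vars tau) (vars tau)) (vars sigma)) :=
  sum_env (sum_env (fun s v => inl (u s (y s (inl v)))) (fun s v => inr v))
    (fun s q => inl (u s (y s (inr q)))).
pose psi1 := rename psi (g (fun s v => inl v)).
pose psi2 := rename psi (g (fun s v => inr v)).
have [E hE] := all_tuple (And (Imp psi1 psi2) (Imp psi2 psi1)).
pose S (M : structure L) (a : tuple_of M tau) (w : tuple_of M sigma) :=
  sat psi (sum_env (sum_env (fun s v => tup_env a (y s (inl v))) (tup_env w))
     (fun s q => tup_env a (y s (inr q)))).
have ES (M : structure L) (a a' : tuple_of M tau) :
    sat E (pair_env a a') <-> forall w, S M a w <-> S M a' w.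
  rewrite hE.
  have H w : sat (And (Imp psi1 psi2) (Imp psi2 psi1))
      (sum_env (pair_env a a') (tup_env w)) <-> (S M a w <-> S M a' w).
    have <- : sat psi1 (sum_env (pair_env a a') (tup_env w)) <-> S M a w.
      rewrite sat_rename /S.
      rewrite [X in _ <-> sat psi X](_ : _ = (fun s v =>
        sum_env (pair_env a a') (tup_env w) (g (fun s v => inl v) s v))) //.
      by apply: env_eq => s [[v|v]|v].
    have <- : sat psi2 (sum_env (pair_env a a') (tup_env w)) <-> S M a' w.
      rewrite sat_rename /S.
      rewrite [X in _ <-> sat psi X](_ : _ = (fun s v =>
        sum_env (pair_env a a') (tup_env w) (g (fun s v => inr v) s v))) //.
      by apply: env_eq => s [[v|v]|v].
    rewrite /And /=; split=> [h|]; last by tauto.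
    by split=> ?; apply: NNPP; tauto.
  by split=> h w; apply/H.
exists k, tau, x, E; split.
  by move=> M _; apply: equivalence_of_code (ES M).
move=> M b b' r; rewrite ES.
have SE (c : tuple_of M sigma) w :
    S M (fun i => sum_env (tup_env c) r (x i)) w <->
    sat psi (sum_env (pair_env c w) r).
  have tE s v : tup_env (fun i => sum_env (tup_env c) r (x i)) (y s v) =
      sum_env (tup_env c) r v.
    by rewrite -[in RHS](hxy s v); case: (y s v).
  rewrite /S [X in sat psi X <-> _](_ : _ = sum_env (pair_env c w) r) //.
  by apply: env_eq => s [[v|v]|v] /=; rewrite ?tE.
by split=> h w; move: (h w); rewrite !SE.
Qed.

Section Imaginaries.
Variables (L : lang) (T : theory L) (M : structure L) (C : paramset M).
Variables (n : nat) (sigma : 'I_n -> sort L).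

(** The tuple [(b, c)], where [c] are parameters from [C]: each coordinate of
    [x] selects a coordinate of [b] or an element of [C]. *)
Definition rep k (tau : 'I_k -> sort L)
    (x : tuple_of (vsum (vars sigma) (params C)) tau) (b : tuple_of M sigma) :
    tuple_of M tau :=
  fun i => sum_env (tup_env b) (fun s (c : params C s) => sval c) (x i).

(** Identifying tuples by the part of [theta] that they select through [E0]
    restricts to [E0] itself on [theta], if [E0] is an equivalence relation
    there. *)
Lemma exists_code (theta : formula_over C (vars sigma))
    (E0 : formula_over C (vsum (vars sigma) (vars sigma))) :
  exists k (tau : 'I_k -> sort L)
      (x : tuple_of (vsum (vars sigma) (params C)) tau)
      (E : formula (vsum (vars tau) (vars tau))),
    equiv_formula T E /\ forall b b',
      sat E (pair_env (rep x b) (rep x b')) <->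
      forall w, holds1 theta w /\ holds2 E0 b w <->
                holds1 theta w /\ holds2 E0 b' w.
Proof.
pose g : env (vsum (vars sigma) (params C))
    (vsum (vsum (vars sigma) (vars sigma)) (params C)) :=
  sum_env (fun s v => inl (inr v)) (fun s c => inr c).
pose phi := And (rename theta g) E0.
have phiE b w : holds phi (pair_env b w) <-> holds1 theta w /\ holds2 E0 b w.
  rewrite holds_And /holds sat_rename /holds1 /holds2 /holds.
  rewrite [X in sat theta X /\ _ <-> _](_ : _ = sum_env (tup_env w)
    (fun s (c : params C s) => sval c)) //.
  by apply: env_eq => s [].
have [Q [p [psi [fQ hpsi]]]] := finite_support phi (fun s v => v).
have [k [tau [x [E [hE Esat]]]]] := exists_imaginary_sort T psi fQ.
pose x' i : vsum (vars sigma) (params C) (tau i) :=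
  match x i with inl v => inl v | inr q => inr (p _ q) end.
have repE b : rep x' b =
    fun i => sum_env (tup_env b) (fun s q => sval (p s q)) (x i).
  by apply: functional_extensionality_dep => i; rewrite /rep /x'; case: (x i).
exists k, tau, x', E; split=> // b b'; rewrite !repE Esat.
have H c w : sat psi (sum_env (pair_env c w) (fun s q => sval (p s q))) <->
    holds1 theta w /\ holds2 E0 c w.
  rewrite -phiE /holds.
  by rewrite (hpsi M (pair_env c w) (fun s (c : params C s) => sval c)).
by split=> h w; move: (h w); rewrite !H.
Qed.

Variables (k : nat) (tau : 'I_k -> sort L).
Variable x : tuple_of (vsum (vars sigma) (params C)) tau.
Variable E : formula (vsum (vars tau) (vars tau)).
Variable hE : equiv_formula T E.

(** [E] has no parameters, but its second argument contains elements of [C]. *)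
Lemma rep_formula : exists phi : formula_over C (vsum (vars tau) (vars sigma)),
  forall t b, holds phi (pair_env t b) <-> sat E (pair_env t (rep x b)).
Proof.
pose y i : vsum (vsum (vars tau) (vars sigma)) (params C) (tau i) :=
  match x i with inl v => inl (inr v) | inr c => inr c end.
exists (rename E (sum_env (fun s v => inl (inl v)) (tup_env y))) => t b.
rewrite /holds sat_rename.
rewrite [X in _ <-> sat E X](_ : _ = (fun s v => sum_env (pair_env t b)
  (fun s (c : params C s) => sval c)
  (sum_env (fun s v => inl (inl v)) (tup_env y) v))) //.
apply: env_eq => s [v|v] //=; case: v => i /=.
by rewrite /rep /y; case: (x i).
Qed.

Definition imag (b : tuple_of M sigma) : eq_structure T M (Quot hE) :=
  cls (fun a a' : tuple_of M tau => sat E (pair_env a a')) (rep x b).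

Lemma definable_imag (V : sort (eq_lang T) -> Type) (u : V (Quot hE))
    (b : forall i, V (Real T (sigma i))) :
  definable (eq_params (T := T) C)
    (fun e : env V (eq_structure T M) => e _ u = imag (fun i => e _ (b i))).
Proof.
pose C' := eq_params (T := T) C.
pose arg i : vsum V (params C') (Real T (tau i)) :=
  match x i with
  | inl v => inl (tup_env (M := fun s => V (Real T s)) b v)
  | inr c => inr c
  end.
exists (@Eq (eq_lang T) (vsum V (params C')) (Quot hE) (Var (inl u))
  (@App (eq_lang T) _ (Proj hE)
    (fun i => @Var (eq_lang T) _ (Real T (tau i)) (arg i)))).
move=> e; rewrite /holds /=.
rewrite (_ : (fun i => sum_env _ _ (arg i)) = rep x (fun i => e _ (b i))) //.
apply: functional_extensionality_dep => i; rewrite /rep /arg.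
by case: (x i) => // v; case: v.
Qed.

Lemma imag_eq (t : tuple_of M tau) (b : tuple_of M sigma) :
  models M T ->
  cls (fun a a' : tuple_of M tau => sat E (pair_env a a')) t = imag b <->
  sat E (pair_env t (rep x b)).
Proof. by move=> hM; apply: cls_eq (hE hM). Qed.

Let N := eq_structure T M.
Let C' : paramset N := eq_params (T := T) C.
Let srt (i : 'I_1) : sort (eq_lang T) := Quot hE.
Let rsrt i : sort (eq_lang T) := Real T (sigma i).

Let definable_real1 (V : sort (eq_lang T) -> Type)
    (theta : formula_over C (vars sigma)) (v : forall i, V (rsrt i)) :
  definable C' (fun e : env V N => holds1 theta (fun i => e _ (v i))).
Proof.
apply: (definable_real theta
  (g := fun e : env V N => tup_env (M := M) (fun i => e _ (v i)))
  (h := tup_env (M := fun s => V (Real T s)) v)).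
by move=> e s; case.
Qed.

Lemma definable_imag_image (theta : formula_over C (vars sigma)) :
  definable C' (fun e : env (vars srt) N => exists b : tuple_of M sigma,
    holds1 theta b /\ e _ (TVar ord0) = imag b).
Proof.
apply: (@definable_ex _ N C' _ rsrt); apply: definable_and.
  exact: (definable_real1 theta (fun i => inr (TVar (sigma := rsrt) i))).
exact: (definable_imag (V := vsum (vars srt) (vars rsrt)) (inl (TVar ord0))
  (fun i => inr (TVar i))).
Qed.

Lemma definable_imag_op (theta : formula_over C (vars sigma))
    (op0 : formula_over C (vsum (vsum (vars sigma) (vars sigma)) (vars sigma))) :
  definable C' (fun e : env (vsum (vsum (vars srt) (vars srt)) (vars srt)) N =>
    exists b1 b2 b3 : tuple_of M sigma,
      ((holds1 theta b1 /\ holds1 theta b2) /\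
       (holds1 theta b3 /\ holds3 op0 b1 b2 b3)) /\
      (e _ (inl (inl (TVar ord0))) = imag b1 /\
       e _ (inl (inr (TVar ord0))) = imag b2 /\
       e _ (inr (TVar ord0)) = imag b3)).
Proof.
pose U := vsum (vsum (vars srt) (vars srt)) (vars srt).
pose W := vsum (vsum (vsum U (vars rsrt)) (vars rsrt)) (vars rsrt).
pose old (u : U (Quot hE)) : W (Quot hE) := inl (inl (inl u)).
pose v1 i : W (rsrt i) := inl (inl (inr (TVar i))).
pose v2 i : W (rsrt i) := inl (inr (TVar i)).
pose v3 i : W (rsrt i) := inr (TVar i).
do 3![apply: (@definable_ex _ N C' _ rsrt)]; apply: definable_and.
  apply: definable_and.
    by apply: definable_and;
      [exact: (definable_real1 theta v1) | exact: (definable_real1 theta v2)].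
  apply: definable_and; first exact: (definable_real1 theta v3).
  apply: (definable_real op0 (g := fun e : env W N =>
      triple_env (M := M) (fun i => e _ (v1 i)) (fun i => e _ (v2 i))
        (fun i => e _ (v3 i)))
    (h := triple_env (M := fun s => W (Real T s)) v1 v2 v3)).
  by move=> e s; do 3?case.
apply: definable_and.
  exact: (definable_imag (V := W) (old (inl (inl (TVar ord0)))) v1).
apply: definable_and.
  exact: (definable_imag (V := W) (old (inl (inr (TVar ord0)))) v2).
exact: (definable_imag (V := W) (old (inr (TVar ord0))) v3).
Qed.

End Imaginaries.

(** * The definable group *)

Lemma inj_surj_bij (A B : Type) (f : A -> B) :
  injective f -> (forall b, exists a, f a = b) -> bijective f.
Proof.
move=> finj fsurj.
pose g b := sval (constructive_indefinite_description _ (fsurj b)).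
have gK : cancel g f.
  by move=> b; rewrite /g; case: constructive_indefinite_description.
by exists g => // a; apply: finj; rewrite gK.
Qed.

Lemma group_graph_transport (A B : Type) (RA : A -> A -> A -> Prop)
    (RB : B -> B -> B -> Prop) (f : A -> B) :
  bijective f -> (forall x y z, RA x y z <-> RB (f x) (f y) (f z)) ->
  group_graph RA -> group_graph RB.
Proof.
move=> [g fK gK] hf [m [mA [e [e1 e2 inv]]] hm].
exists (fun x y => f (m (g x) (g y))); last first.
  move=> x y z; rewrite -[x in RB x]gK -[y in RB _ y]gK -[z in RB _ _ z]gK.
  by rewrite -hf hm; split=> [->|<-]; rewrite ?fK ?gK.
split; first by move=> x y z; rewrite !fK mA.
exists (f e); split=> [x|x|x]; first by rewrite fK e1 gK.
  by rewrite fK e2 gK.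
by have [y [y1 y2]] := inv (g x); exists (f y); rewrite !fK y1 y2.
Qed.

Theorem proposition5p11
  (L' : lang) (L : sublang L') (T : theory L) (T' : theory L')
  (M : structure L') (K : Type)
  (hT : complete T) (hT' : complete T') (hTT' : subtheory T T')
  (hM : models M T') (hmonster : monster K M)
  (C : paramset M) (hC : small K C)
  (H : def_group C) (G : hyp_group (reduct_params (L := L) C))
  (iota : type_over C
    (vsum (vars (dg_sort H)) (vars (fun j => sval (hg_sort G j)))))
  (hiota : type_definable_iso iota) :
  exists (G0 : def_group (eq_params (T := T) (reduct_params (L := L) C))),
    definably_isomorphic H G0.
Proof.
have [_ _ hsat _] := hmonster.
have [theta [delta [E0 [op0 [surj inj total eqvE opE]]]]] :=
  relatively_definable hiota hsat hC.
pose Graph x y := dg_set H x /\ holds delta (pair_env x y).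
have [k [tau [x [E [hE codeE]]]]] := exists_code T theta E0.
have hMT : models (reduct L M) T by exact: models_reduct hM.
pose pt := imag x hE.
have ptE b b' : holds1 theta b -> holds1 theta b' ->
    pt b = pt b' <-> exists a, Graph a b /\ Graph a b'.
  move=> hb hb'; rewrite imag_eq ?codeE //.
  split=> [/(_ b)|[a [ab ab']] w].
    have [a ab] := surj _ hb.
    case=> /(_ _)[|_ /(eqvE _ _ hb' hb)[a' [? ?]]]; last by exists a'.
    by split=> //; apply/eqvE => //; exists a.
  (* [w] is [E0]-related to either of [b] and [b'] iff its image is [a]. *)
  have E0a c : holds1 theta c -> Graph a c ->
      holds1 theta w /\ holds2 E0 c w <-> holds1 theta w /\ Graph a w.
    move=> hc ac; split=> -[hw]; last by split=> //; apply/eqvE => //; exists a.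
    move=> /(eqvE _ _ hc hw)[a' [a'c a'w]]; split=> //.
    by rewrite (inj _ _ _ hc ac a'c).
  by rewrite (E0a b) // (E0a b').
pose N := eq_structure T (reduct L M).
pose C' := eq_params (T := T) (reduct_params (L := L) C).
pose srt (i : 'I_1) : sort (eq_lang T) := Quot hE.
have [dom domE] := definable_imag_image x hE theta.
have [gop gopE] := definable_imag_op x hE theta op0.
pose S (u : tuple_of N srt) := holds dom (tup_env u).
have SE u : S u <-> exists b, holds1 theta b /\ u ord0 = pt b.
  exact: iff_sym (domE (tup_env u)).
pose RB (u1 u2 u3 : sig S) :=
  holds gop (triple_env (sval u1) (sval u2) (sval u3)).
have RBE u1 u2 u3 : RB u1 u2 u3 <-> exists b1 b2 b3,
    ((holds1 theta b1 /\ holds1 theta b2) /\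
     (holds1 theta b3 /\ holds3 op0 b1 b2 b3)) /\
    (sval u1 ord0 = pt b1 /\ sval u2 ord0 = pt b2 /\ sval u3 ord0 = pt b3).
  exact: iff_sym (gopE (triple_env (sval u1) (sval u2) (sval u3))).
(* The isomorphism sends [a] to the class of any element of its fibre. *)
have hf (a : sig (dg_set H)) : exists u : sig S,
    exists b, [/\ holds1 theta b, Graph (sval a) b & sval u ord0 = pt b].
  case: a => a ha; have [b hb ab] := total a ha.
  have Su : S (fun _ => pt b) by apply/SE; exists b.
  by exists (exist S _ Su), b.
pose f a := sval (constructive_indefinite_description _ (hf a)).
have fP a : exists b,
    [/\ holds1 theta b, Graph (sval a) b & sval (f a) ord0 = pt b].
  by rewrite /f; case: constructive_indefinite_description.
have fE a b : holds1 theta b -> sval (f a) ord0 = pt b <-> Graph (sval a) b.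
  move=> hb; have [b' [hb' ab' ->]] := fP a.
  rewrite ptE //; split=> [[a' [a'b' a'b]]|ab]; last by exists (sval a).
  by rewrite (inj _ _ _ hb' ab' a'b').
have fbij : bijective f.
  apply: inj_surj_bij => [a a' E'|u].
    have [b [hb ab fa]] := fP a; move: fa; rewrite E' fE // => a'b.
    by apply: sig_eq; apply: inj hb ab a'b.
  have [b [hb ub]] := proj1 (SE _) (svalP u).
  have [a ab] := surj _ hb; exists (exist _ a (proj1 ab)).
  apply: sig_eq; apply: functional_extensionality_dep => i; rewrite (ord1 i) ub.
  exact/fE.
have fop a1 a2 a3 : dg_graph H a1 a2 a3 <-> RB (f a1) (f a2) (f a3).
  rewrite RBE; split=> [o|[b1 [b2 [b3 [[[h1 h2] [h3 o]]]]]]].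
    have [b1 [h1 ab1 fb1]] := fP a1; have [b2 [h2 ab2 fb2]] := fP a2.
    have [b3 [h3 ab3 fb3]] := fP a3.
    exists b1, b2, b3; do !split=> //.
    by apply/opE => //; exists (sval a1), (sval a2), (sval a3).
  rewrite !fE // => -[ab1 [ab2 ab3]].
  have [a1' [a2' [a3' [ab1' ab2' ab3' o']]]] := proj1 (opE _ _ _ h1 h2 h3) o.
  rewrite /dg_graph (inj _ _ _ h1 ab1 ab1') (inj _ _ _ h2 ab2 ab2').
  rewrite (inj _ _ _ h3 ab3 ab3').
  exact: o'.
have grpB : group_graph RB := group_graph_transport fbij fop (dg_group H).
pose G0 : def_group C' := @DefGroup _ N C' 1 srt dom gop grpB.
exists G0.
pose rsort (p : {i & 'I_(rep_arity (dg_sort G0 i))}) : sort L' :=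
  sval (reps_sort (dg_sort G0) p).
(* [iota'] says that the tuple representing the imaginary is [E]-equivalent to
   one coming from the fibre over [a]. *)
have [phi phiE] := rep_formula x E.
pose Z := vsum (vars (dg_sort H)) (vars rsort).
have [iota' iotaE] : definable C (fun e : env Z M =>
    exists b : tuple_of M (fun i => sval (hg_sort G i)),
      ((dg_set H (fun i => e _ (inl (TVar i))) /\
        holds delta (pair_env (fun i => e _ (inl (TVar i))) b)) /\
       holds1 theta b) /\
      holds phi (pair_env (M := reduct L M) (sigma := tau) (tau := hg_sort G)
        (fun j => e _ (inr (TVar (existT _ ord0 j)))) b)).
  pose W := vsum Z (vars (fun i => sval (hg_sort G i))).
  pose va i : W (dg_sort H i) := inl (inl (TVar i)).
  pose vt j : W (sval (tau j)) :=
    inl (inr (TVar (sigma := rsort) (existT _ ord0 j))).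
  pose vy i : W (sval (hg_sort G i)) := inr (TVar i).
  apply: definable_ex; do ![apply: definable_and].
  - by apply: (definable_holds (dg_dom H) (h := tup_env va)) => e s; case.
  - apply: (definable_holds delta
      (h := pair_env (tau := fun i => sval (hg_sort G i)) va vy)) => e s.
    by do 2?case.
  - apply: (definable_lift theta (g := fun e : env W M =>
        tup_env (M := reduct L M) (sigma := hg_sort G) (fun i => e _ (vy i)))
      (h := tup_env (M := fun s => W (sval s)) vy)).
    by move=> e s; case.
  - apply: (definable_lift phi (g := fun e : env W M =>
        pair_env (M := reduct L M) (sigma := tau) (tau := hg_sort G)
          (fun j => e _ (vt j)) (fun i => e _ (vy i)))
      (h := pair_env (M := fun s => W (sval s)) vt vy)).
    by move=> e s; do 2?case.
exists iota', f; first by split=> // a1 a2 a3 /fop.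
move=> a b; apply: iff_trans (iff_sym (iotaE (pair_env a b))) _.
split=> [[y [[[ha ay] hy] ety]]|[ha fab]].
- exists ha; apply: functional_extensionality_dep => i; rewrite (ord1 i).
  have -> : sval (f (exist _ a ha)) ord0 = pt y by apply/fE.
  by apply: esym; apply/imag_eq => //; apply/phiE.
- have [y [hy ay fay]] := fP (exist _ a ha).
  exists y; split=> //; apply/phiE/(imag_eq x hE) => //.
  by rewrite -/pt -fay fab.
Qed.
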